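(* Let $n\ge2$ and $p\in[0,1]$. Let $M_n$ be the disjoint union of $n$ copies of $K_2$ and $T_n$ the disjoint union of $n$ copies of $K_3$. Let $\mathcal{G}$ be a random graph which equals $M_n$ with probability $p$ and $T_n$ with probability $1-p$, and let $X$ be the number of crossings in a uniformly random embedding of $\mathcal{G}$. Let $\mu_M,\sigma_M^2$ (respectively $\mu_T,\sigma_T^2$) be the mean and variance of the number of crossings in a uniformly random embedding of $M_n$ (respectively $T_n$), and let $Z_M\sim N(\mu_M,\sigma_M^2)$, $Z_T\sim N(\mu_T,\sigma_T^2)$. Then $$d_K\left(F_X,\ pF_{Z_M}+(1-p)F_{Z_T}\right)\le\frac{3620}{\sqrt n}.$$
   Context: Let $G=(V,E)$ be a finite simple graph with vertex set $V=[N]=\{1,\dots,N\}$. For a permutation $\pi\in S_N$, the embedding $G_\pi$ is the graph on $[N]$ in which $(\pi(v),\pi(w))$ is an edge if and only if $(v,w)\in E$. A crossing in $G_\pi$ is a quadruple $(a,b,c,d)$ of vertices with $(a,b),(c,d)\in E$ and $\pi(a)>\pi(c)>\pi(b)>\pi(d)$. A uniformly random embedding of $G$ is $G_\pi$ with $\pi$ uniformly random in $S_N$. For a random graph $\mathcal{G}$, conditionally on $\mathcal{G}=G$ the variable $X$ is distributed as the number of crossings in a uniformly random embedding of $G$. $F_Y$ denotes the cumulative distribution function of $Y$, and $d_K(F,H)=\sup_{x\in\mathbb{R}}|F(x)-H(x)|$ for cumulative distribution functions $F,H$. *)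

(* Defs.v *)
From HB Require Import structures.
From mathcomp Require Export all_boot all_order all_algebra all_fingroup.
From mathcomp Require Export all_classical all_reals all_analysis.

Set Implicit Arguments.
Unset Strict Implicit.
Unset Printing Implicit Defensive.

Import Order.TTheory GRing.Theory Num.Theory.

Local Open Scope classical_set_scope.
Local Open Scope ring_scope.

(* The vertex set [N] is shifted to {0, ..., N - 1}, i.e. 'I_N. *)
Record sgraph := SGraph {
  nverts : nat;
  edge : rel 'I_nverts;
  edge_sym : symmetric edge;
  edge_irr : irreflexive edge }.

Definition clique_copies_edge (n r : nat) : rel 'I_(n * r) :=
  fun i j => (i != j) && (i %/ r == j %/ r)%N.

Lemma clique_copies_sym n r : symmetric (@clique_copies_edge n r).
Proof. by move=> i j; rewrite /clique_copies_edge eq_sym [X in _ && X]eq_sym. Qed.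

Lemma clique_copies_irr n r : irreflexive (@clique_copies_edge n r).
Proof. by move=> i; rewrite /clique_copies_edge eqxx. Qed.

(* Disjoint union of n copies of the complete graph K_r: the k-th copy lives on
   the vertices k r, ..., k r + r - 1. *)
Definition clique_copies (n r : nat) : sgraph :=
  SGraph (@clique_copies_sym n r) (@clique_copies_irr n r).

(* The strict order s a > s c > s b > s d makes a and c the larger endpoints of
   their edges, so each crossing pair of edges is counted exactly once. *)
Definition crossings (G : sgraph) (s : 'S_(nverts G)) : nat :=
  #|[pred q : 'I_(nverts G) * 'I_(nverts G) * 'I_(nverts G) * 'I_(nverts G) |
     let: (a, b, c, d) := q in
     [&& edge a b, edge c d, (s c < s a)%N, (s b < s c)%N & (s d < s b)%N]]|.

Section discrete_perm.
Variable T : finType.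

HB.instance Definition _ := isPointed.Build (perm_type T) 1%g.

HB.instance Definition _ := @isMeasurable.Build default_measure_display
  (perm_type T) discrete_measurable discrete_measurable0
  discrete_measurableC discrete_measurableU.

End discrete_perm.

Section uniform_perm.
Variables (R : realType) (N : nat).
Local Open Scope ereal_scope.

Definition uniform_perm (A : set 'S_N) : \bar R :=
  (#|[pred s : 'S_N | s \in A]|%:R / (N`!)%:R)%R%:E.

Let uniform_permE A : uniform_perm A =
  mscale (((N`!)%:R^-1)%:nng)%R
    (msum (fun k => \d_(nth 1%g (enum 'S_N) k)) #|'S_N|) A.
Proof.
rewrite /mscale /msum /= /uniform_perm mulrC EFinM; congr (_ * _).
transitivity (\sum_(k < #|'S_N|) ((enum_val k \in A)%:R : R)%:E); last first.
  apply: eq_bigr => k _; rewrite [RHS]diracE; congr ((_ (_ \in A))%:R%:E).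
  by apply: set_nth_default; rewrite -cardE.
rewrite -(big_enum_val (fun s : 'S_N => ((s \in A)%:R : R)%:E)) /=.
rewrite sumEFin; congr (_%:E).
rewrite -sum1_card natr_sum big_mkcond/= [RHS]big_mkcond/=.
by apply: eq_bigr => s _; rewrite !inE; case: (s \in A).
Qed.

Let uniform_perm0 : uniform_perm set0 = 0.
Proof. by rewrite uniform_permE measure0. Qed.

Let uniform_perm_ge0 A : 0 <= uniform_perm A.
Proof. by rewrite uniform_permE measure_ge0. Qed.

Let uniform_perm_sigma_additive : semi_sigma_additive uniform_perm.
Proof.
have -> : uniform_perm = mscale (((N`!)%:R^-1)%:nng)%R
    (msum (fun k => \d_(nth 1%g (enum 'S_N) k)) #|'S_N|).
  by apply/funext => A; exact: uniform_permE.
exact: measure_semi_sigma_additive.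
Qed.

HB.instance Definition _ := isMeasure.Build _ _ _ uniform_perm
  uniform_perm0 uniform_perm_ge0 uniform_perm_sigma_additive.

Let uniform_perm_setT : uniform_perm setT = 1.
Proof.
rewrite /uniform_perm (eq_card (B := 'S_N)); last first.
  by move=> s; rewrite inE in_setT.
by rewrite card_Sn divff// pnatr_eq0 -lt0n fact_gt0.
Qed.

HB.instance Definition _ := Measure_isProbability.Build _ _ _
  uniform_perm uniform_perm_setT.

End uniform_perm.

Arguments uniform_perm R N A : clear implicits.

Section crossing_variable.
Variables (R : realType) (G : sgraph).

Definition crossing_rv (s : 'S_(nverts G)) : R := (crossings s)%:R.

Lemma measurable_crossing_rv : measurable_fun setT crossing_rv.
Proof. by []. Qed.

HB.instance Definition _ := isMeasurableFun.Build _ _ _ _ crossing_rv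
  measurable_crossing_rv.

Definition crossing_law : probability R R :=
  distribution (uniform_perm R (nverts G))
    (crossing_rv : {mfun 'S_(nverts G) >-> R}).

Definition crossing_mean : R := fine 'E_(uniform_perm R (nverts G))[crossing_rv].

Definition crossing_variance : R :=
  fine 'V_(uniform_perm R (nverts G))[crossing_rv].

End crossing_variable.

HB.instance Definition _ := gen_eqMixin sgraph.
HB.instance Definition _ := gen_choiceMixin sgraph.
HB.instance Definition _ := isPointed.Build sgraph (clique_copies 0 0).
HB.instance Definition _ := @isMeasurable.Build default_measure_display
  sgraph discrete_measurable discrete_measurable0
  discrete_measurableC discrete_measurableU.

(* Conditionally on GG = G, X is the number of crossings of a uniformly random
   embedding of G, for every graph G. *)
Definition crossings_of_random_embedding (R : realType) (d : measure_display)
    (Omega : measurableType d) (P : probability Omega R)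
    (GG : {RV P >-> sgraph}) (X : {RV P >-> R}) : Prop :=
  forall (G : sgraph) (A : set R), measurable A ->
    P (GG @^-1` [set G] `&` X @^-1` A) =
    (P (GG @^-1` [set G]) * crossing_law R G A)%E.

(* normal_prob takes the standard deviation; it is N(m, v) only for v > 0. *)
Definition normal_rv (R : realType) (d : measure_display)
    (Omega : measurableType d) (P : probability Omega R) (Z : {RV P >-> R})
    (m v : R) : Prop :=
  forall A : set R, measurable A ->
    distribution P Z A = normal_prob m (Num.sqrt v) A.

Definition kolmogorov_distance (R : realType) (F H : R -> \bar R) : \bar R :=
  ereal_sup (range (fun x => `|F x - H x|%E)).

(* Main.v *)
Require Import Defs.
From mathcomp Require Import lra zify.

Set Implicit Arguments.
Unset Strict Implicit.
Unset Printing Implicit Defensive.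

Import Order.TTheory GRing.Theory Num.Theory.
Import numFieldNormedType.Exports.
Local Open Scope classical_set_scope.
Local Open Scope ring_scope.

(* Conditioning on the graph reduces the claim to a Berry-Esseen bound for n disjoint copies of
   K_r, r = 2, 3.  The order pattern of independent uniform points of {0, ..., M - 1} is that of
   a uniform permutation as soon as the points are distinct, so it suffices to treat such points
   and let M tend to infinity.  In this model the number of crossings is a U-statistic of order 2
   in the n independent copies (a K_r with r <= 3 does not cross itself).  Resampling one copy
   gives an exchangeable pair (W, W') with n E[W - W' | V] = W + remainder, to which the bound of
   Shao and Zhang applies: the Stein solution f has w f(w) and -1_(w <= z) nondecreasing, so by
   antisymmetry d_K is at most a constant times
     E|1 - n E[D^2 | V] / 2| + n E|E[D |D| | V]| + E|remainder|,   D = W - W',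
   and each term is O(1 / sqrt n) by the bounded differences variance inequality and by the
   orthogonality of the degenerate part.  The variance is of order n^3 because the conditional
   crossing probability of a chord depends only on its circular length, which makes the chord
   kernel itself degenerate and its variance explicit. *)

(** * Stein's equation for the normal distribution *)

(** Points are drawn from a finite grid rather than from an interval, so every expectation before
    the limit is a finite average [avg], and measure theory enters only when the laws of the
    statement are unfolded. The obstacle is the lower bound on the variance. Bounded differences
    control the errors only up to order n^(5/2), which is small against a variance of order n^3 but
    useless if the linear part of the crossing number were degenerate. The expected number of
    crossings of a fixed copy with a random one is, up to a factor, again a U-statistic of order 2,
    over the r points of that copy. The same decomposition is therefore used twice: over n copies
    for the bound and over r points for the variance. The degenerate variance of the chord kernel
    tends to 1/30 - 1/36 = 1/180. The estimates assume n >= 100 and a fine grid; for n < 100 the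
    claimed bound exceeds 1. They add up to 3100 + 5 * 20 = 3200, so 3620 leaves some room. *)

Section real_calculus.
Variable R : realType.

Lemma scaleRE (a b : R) : a *: (b : R^o) = a * b.
Proof. by []. Qed.

Lemma is_derive_expR_halfsq (e w : R) :
  is_derive w 1 (fun x : R => expR (e * (x ^+ 2 / 2))) (e * w * expR (e * (w ^+ 2 / 2))).
Proof.
have h : is_derive w (1 : R) (fun x : R => e * (x ^+ 2 / 2)) (e * w).
  have -> : (fun x : R => e * (x ^+ 2 / 2)) = (e / 2) \*: ((@id R) ^+ 2).
    by apply/funext => x; rewrite /GRing.scale /= /GRing.scale /= exprfctE; lra.
  by apply: is_derive_eq; rewrite /GRing.scale /=; lra.
have := @is_derive1_comp R expR (fun x : R => e * (x ^+ 2 / 2)) w _ _ (is_derive_expR _) h.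
by move=> h2; apply: (is_derive_eq h2); rewrite mulrC.
Qed.

Lemma is_derive_continuous (f df : R -> R) :
  (forall x : R, is_derive x 1 f (df x)) -> continuous f.
Proof.
move=> h x; apply: differentiable_continuous; apply/derivable1_diffP.
by have [] := h x.
Qed.

Lemma MVT_all (f df : R -> R) (a b : R) :
  (forall x : R, is_derive x 1 f (df x)) -> a < b ->
  exists2 c, a < c < b & f b - f a = df c * (b - a).
Proof.
move=> h ab; have [|c] := MVT ab (fun x _ => h x).
  by apply: continuous_subspaceT; exact: (is_derive_continuous (fun x => h x)).
by rewrite in_itv/=; exists c.
Qed.

Lemma ge0_derive_le (f df : R -> R) (a b : R) : 
  (forall x : R, a <= x <= b -> is_derive x 1 f (df x)) -> 
  (forall x : R, a <= x <= b -> 0 <= df x) ->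
  a <= b -> f a <= f b.
Proof.
move=> h df0 ab; rewrite -subr_ge0.
have [||c] := @MVT_segment R f df a b ab.
- by move=> x; rewrite in_itv/= => /andP[? ?]; apply: h; lra.
- apply: derivable_within_continuous => x; rewrite in_itv/= => xab.
  by have [] := h _ xab.
by rewrite in_itv/= => cab ->; rewrite mulr_ge0 ?subr_ge0 ?df0.
Qed.

End real_calculus.

(** * Mills ratio inequalities *)

Section mills_ratio.
Variables (R : realType) (c : R) (Phi : R -> R).

Definition gauss_density (w : R) := c * expR (-1 * (w ^+ 2 / 2)).
Local Notation phi := gauss_density.

(* [Phi / phi], which is the Mills ratio at [- w] when [Phi] is the normal distribution function. *)
Definition mills (w : R) := Phi w * (c^-1 * expR (1 * (w ^+ 2 / 2))).

Hypothesis c0 : 0 < c.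
Hypothesis Phi' : forall w : R, is_derive w 1 Phi (phi w).
Hypothesis Phi_ge0 : forall w, 0 <= Phi w.
Hypothesis Phi_ny : forall e w : R, 0 < e -> exists2 v, v < w & Phi v < e.

Lemma gauss_density_gt0 (w : R) : 0 < phi w.
Proof. by rewrite mulr_gt0 ?expR_gt0. Qed.

Lemma gauss_density_le (w : R) : phi w <= c.
Proof.
rewrite -[leRHS]mulr1 ler_pM2l// -[leRHS]expR0 ler_expR.
by have := sqr_ge0 w; lra.
Qed.

Lemma gauss_densityV (w : R) : phi w * (c^-1 * expR (1 * (w ^+ 2 / 2))) = 1.
Proof.
rewrite /phi mulrACA divff ?gt_eqF// [LHS]mul1r -expRD -[RHS]expR0.
by congr expR; lra.
Qed.

Lemma is_derive_gauss_density (w : R) : is_derive w 1 phi (- w * phi w).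
Proof.
have := is_derive_expR_halfsq (-1) w => h.
have -> : phi = c \*: (fun x => expR (-1 * (x ^+ 2 / 2))) by [].
apply: is_derive_eq; rewrite /phi !scaleRE /= ?scaleRE; lra.
Qed.

Lemma millsE (w : R) : phi w * mills w = Phi w.
Proof. by rewrite /mills mulrCA gauss_densityV mulr1. Qed.

Lemma is_derive_mills (w : R) : is_derive w 1 mills (1 + w * mills w).
Proof.
have h := is_derive_expR_halfsq 1 w.
have h2 : is_derive w 1 (Phi * (c^-1 \*: (fun x => expR (1 * (x ^+ 2 / 2)))))
    (1 + w * mills w).
  apply: is_derive_eq; rewrite -[X in _ = X + _](gauss_densityV w).
  rewrite /mills !scaleRE /= ?scaleRE; lra.
exact: h2.
Qed.

Lemma mills_ge0 (w : R) : 0 <= mills w.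
Proof. by rewrite mulr_ge0// mulr_ge0 ?expR_ge0// invr_ge0 ltW. Qed.

(** The function [- (Phi x + phi x / x)] has derivative [phi x / x ^ 2], so it is nondecreasing on
    the negative axis. It is at least [- Phi x], which is arbitrarily close to 0 far to the left,
    hence it is nonnegative. *)
Lemma Phi_mills_upper (w : R) : w < 0 -> - w * Phi w <= phi w.
Proof.
move=> w0.
pose K (x : R) := - (Phi x + phi x * x^-1).
have K' (x : R) : x < 0 -> is_derive x 1 K (phi x * x^-1 ^+ 2).
  move=> x0; have xn : (@id R) x != 0 by rewrite /= lt_eqF.
  have h1 := is_derive_gauss_density x.
  have h2 := is_deriveV xn (is_derive_id x 1).
  suff h : is_derive x 1 (- (Phi + phi * (fun y : R => (id y)^-1)))
    (phi x * x^-1 ^+ 2) by exact: h.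
  apply: (is_derive_eq (is_deriveN (is_deriveD (Phi' x) (is_deriveM h1 h2)))).
  rewrite !scaleRE /= ?scaleRE expr2 invfM.
  rewrite /= in xn.
  have -> : x^-1 * (- x * phi x) = - phi x by rewrite mulrA mulrN mulVf// mulN1r.
  by rewrite expr2; lra.
have Kmon (v : R) : v < w -> K v <= K w.
  move=> vw; apply: (@ge0_derive_le R K (fun x => phi x * x^-1 ^+ 2)).
  - by move=> x /andP[_ xw]; apply: K'; lra.
  - by move=> x _; rewrite mulr_ge0 ?sqr_ge0 ?ltW ?gauss_density_gt0.
  - exact: ltW.
have Kge : 0 <= K w.
  rewrite leNgt; apply/negP => Kw.
  have [v vw hv] := @Phi_ny (- K w) w ltac:(lra).
  have := Kmon v vw; rewrite {1}/K.
  have : phi v * v^-1 <= 0.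
    rewrite mulr_ge0_le0 ?invr_le0 ?ltW ?gauss_density_gt0//; lra.
  lra.
move: Kge; rewrite /K oppr_ge0 => h.
have : (Phi w + phi w / w) * w >= 0 by rewrite mulr_le0// ltW.
by rewrite mulrDl divfK ?lt_eqF// => ?; lra.
Qed.

(** Divided by [phi w], the right-hand side is the derivative of [w * mills w], whose monotonicity
    is the aim. The function [J] is nondecreasing and cannot be negative, since its values far to
    the left are almost nonnegative. *)
Lemma Phi_mills_lower (w : R) : 0 <= (1 + w ^+ 2) * Phi w + w * phi w.
Proof.
pose u (x : R) := (1 + x ^+ 2)^-1.
have u0 (x : R) : 0 < 1 + x ^+ 2 by have := sqr_ge0 x; lra.
pose J x := Phi x + phi x * (x * u x).
have J' (x : R) : is_derive x 1 J (2 * phi x * u x ^+ 2).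
  have xn : (cst 1 + (@id R) ^+ 2 : R -> R) x != 0.
    by rewrite /= gt_eqF// [ltRHS](_ : _ = 1 + x ^+ 2)//.
  have h1 := is_derive_gauss_density x.
  have h0 : is_derive x 1 (cst 1 + (@id R) ^+ 2 : R -> R) (2 * x).
    have hX := is_deriveX 2 (is_derive_id x (1 : R)).
    have hD := is_deriveD (is_derive_cst (1 : R) x (1 : R)) hX.
    apply: (is_derive_eq hD).
    by rewrite !scaleRE /= ?scaleRE; lra.
  have h2 := is_deriveV xn h0.
  suff h : is_derive x 1
    (Phi + phi * (id * (fun y : R => ((cst 1 + (@id R) ^+ 2 : R -> R) y)^-1)))
    (2 * phi x * u x ^+ 2) by exact: h.
  apply: (is_derive_eq (is_deriveD (Phi' x) (is_deriveM h1 (is_deriveM (is_derive_id x 1) h2)))).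
  rewrite !scaleRE /= ?scaleRE.
  rewrite [(cst 1 + _) x](_ : _ = 1 + x ^+ 2)//.
  rewrite -/(u x) exprVn -/(u x).
  have hu : u x * (1 + x ^+ 2) = 1 by rewrite mulVf ?gt_eqF.
  have -> : ((1 + x ^+ 2) ^+ 2)^-1 = u x ^+ 2 by rewrite exprVn.
  have e1 : u x * x ^+ 2 = 1 - u x by lra.
  have e2 : u x ^+ 2 * x ^+ 2 = u x - u x ^+ 2.
    by rewrite expr2 -mulrA e1; lra.
  have -> : phi x + (phi x * (x * (- u x ^+ 2 * (2 * x)) + u x * 1) + x * u x * (- x * phi x))
    = phi x * (1 + u x - 2 * (u x ^+ 2 * x ^+ 2) - u x * x ^+ 2) by lra.
  by rewrite e1 e2; lra.
have Jmon (v : R) : v <= w -> J v <= J w.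
  apply: (@ge0_derive_le R J (fun x => 2 * phi x * u x ^+ 2)).
  by move=> x _; rewrite mulr_ge0 ?sqr_ge0// mulr_ge0// ltW ?gauss_density_gt0.
have Jge : 0 <= J w.
  rewrite leNgt; apply/negP => Jw.
  (* The crude bound [phi <= c] suffices: as [m] exceeds [c / (- J w)], the negative part of
     [J (- m)] is smaller than [- J w], against [J (- m) <= J w]. *)
  pose m := `|w| + 1 + c / (- J w).
  have d0 : 0 < - J w by lra.
  have m1 : 1 <= m.
    have : 0 <= c / (- J w) by rewrite divr_ge0 ?ltW.
    by rewrite /m; have := normr_ge0 w; lra.
  have mw : - m <= w.
    have : 0 <= c / (- J w) by rewrite divr_ge0 ?ltW.
    by have := ler_norm (- w); rewrite normrN /m; lra.
  have md : c + (- J w) <= m * (- J w).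
    rewrite /m mulrDl divfK ?gt_eqF//.
    by have := normr_ge0 w; nra.
  have := Jmon _ mw; rewrite {1}/J => h.
  have := Phi_ge0 (- m) => h1.
  have h2 : phi (- m) * m * u (- m) < - J w.
    rewrite /u sqrrN ltr_pdivrMr//.
    have := gauss_density_le (- m) => h3.
    have h4 : phi (- m) * m <= c * m by rewrite ler_pM2r//; lra.
    apply: (le_lt_trans h4); nra.
  nra.
have : 0 <= J w * (1 + w ^+ 2) by rewrite mulr_ge0// ltW.
rewrite /J mulrDl mulrA -[_ * u w * _]mulrA /u mulVf ?gt_eqF// mulr1; lra.
Qed.

Lemma mills_lower (w : R) : 0 <= (1 + w ^+ 2) * mills w + w.
Proof.
have := Phi_mills_lower w; rewrite -millsE => h.
have := gauss_density_gt0 w => p0.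
by rewrite -(pmulr_rge0 _ p0); lra.
Qed.

Lemma mills_upper (w : R) : w < 0 -> - 1 <= w * mills w.
Proof.
move=> w0; have := Phi_mills_upper w0; rewrite -millsE => h.
have p0 := gauss_density_gt0 w.
have : 0 <= phi w * (1 + w * mills w) by lra.
by rewrite pmulr_rge0//; lra.
Qed.

Lemma mulid_mills_nondecreasing (a b : R) : a <= b -> a * mills a <= b * mills b.
Proof.
apply: (@ge0_derive_le R (fun x => x * mills x) (fun x => (1 + x ^+ 2) * mills x + x)).
  move=> x _; have h := is_derive_mills x.
  suff h1 : is_derive x 1 (id * mills) ((1 + x ^+ 2) * mills x + x) by exact: h1.
  by apply: is_derive_eq; rewrite !scaleRE /= ?scaleRE; lra.
by move=> x _; exact: mills_lower.
Qed.

Lemma mills_increment (a b : R) : a < b ->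
  (b - a) * (1 + a * mills a) <= mills b - mills a <= (b - a) * (1 + b * mills b).
Proof.
move=> ab; have [x /andP[ax xb] ->] := MVT_all is_derive_mills ab.
have := mulid_mills_nondecreasing (ltW ax).
have := mulid_mills_nondecreasing (ltW xb) => h1 h2.
by rewrite [X in _ <= X <= _]mulrC !ler_pM2l ?subr_gt0// !lerD2l h1 h2.
Qed.

End mills_ratio.

(** * Bounds on the Stein solution *)

Section stein_solution.
Variables (R : realType) (c : R).
Local Notation phi := (gauss_density c).

(* All that Stein's method needs of the normal distribution function; the value of
   [c = 1 / sqrt (2 pi)] never matters. *)
Record gauss_cdf (Phi : R -> R) : Prop := GaussCdf {
  gauss_cdf_c0 : 0 < c;
  gauss_cdf_derive : forall w : R, is_derive w 1 Phi (phi w);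
  gauss_cdf_ge0 : forall w : R, 0 <= Phi w;
  gauss_cdf_le1 : forall w : R, Phi w <= 1;
  gauss_cdf_ny : forall e w : R, 0 < e -> exists2 v, v < w & Phi v < e;
  gauss_cdf_y : forall e w : R, 0 < e -> exists2 v, w < v & 1 - Phi v < e }.

(** By reflection, the branch of the Stein solution to the right of [z] becomes a left branch for
    [1 - Phi (- x)], so Mills estimates are proved on one side only. *)
Lemma gauss_cdf_opp Phi : gauss_cdf Phi -> gauss_cdf (fun x => 1 - Phi (- x)).
Proof.
move=> [c0 d p0 p1 ny y]; split => //.
- move=> w.
  have h1 := @is_derive1_comp R Phi -%R w _ _ (d (- w)) (is_deriveN (is_derive_id w 1)).
  have h2 := is_deriveB (is_derive_cst (1 : R) w (1 : R)) h1.
  apply: (is_derive_eq h2).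
  by rewrite /gauss_density sqrrN; lra.
- by move=> w; have := p1 (- w); lra.
- by move=> w; have := p0 (- w); lra.
- move=> e w e0; have [v vw hv] := y e (- w) e0.
  by exists (- v); rewrite ?opprK//; lra.
- move=> e w e0; have [v vw hv] := ny e (- w) e0.
  by exists (- v); rewrite ?opprK//; lra.
Qed.

Variables (Phi : R -> R) (z : R).
Hypothesis HPhi : gauss_cdf Phi.

Let Psi x := 1 - Phi (- x).
Let HPsi : gauss_cdf Psi := gauss_cdf_opp HPhi.

(* Bounded solution of [f' w - w f w = 1_(w <= z) - Phi z], the derivative at z
   being a left derivative. *)
Definition stein_sol (w : R) : R :=
  if w <= z then (1 - Phi z) * mills c Phi w
  else Phi z * mills c (fun x => 1 - Phi (- x)) (- w).
Local Notation f := stein_sol.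

Definition stein_jump (w : R) : R := (w <= z)%R%:R - Phi z.

Let f_le (w : R) : w <= z -> f w = (1 - Phi z) * mills c Phi w.
Proof. by rewrite /f => ->. Qed.

Let f_ge (w : R) : z <= w -> f w = Phi z * mills c Psi (- w).
Proof.
rewrite le_eqVlt => /predU1P[<-|zw]; last by rewrite /f leNgt zw.
rewrite f_le// /mills /Psi opprK sqrrN; lra.
Qed.

Let p0 : 0 <= Phi z. Proof. exact: gauss_cdf_ge0. Qed.
Let p1 : Phi z <= 1. Proof. exact: gauss_cdf_le1. Qed.

Let q0 (w : R) : 0 <= mills c Phi w.
Proof. by case: HPhi => *; exact: mills_ge0. Qed.
Let q0' w : 0 <= mills c Psi w.
Proof. by case: HPsi => *; exact: mills_ge0. Qed.

Let mono (x y : R) : x <= y -> x * mills c Phi x <= y * mills c Phi y.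
Proof. by case: HPhi => *; exact: mulid_mills_nondecreasing. Qed.
Let mono' (x y : R) : x <= y -> x * mills c Psi x <= y * mills c Psi y.
Proof. by case: HPsi => *; exact: mulid_mills_nondecreasing. Qed.

Lemma stein_sol_ge0 w : 0 <= f w.
Proof.
rewrite /f; case: ifP => _; first by rewrite mulr_ge0// subr_ge0.
by rewrite mulr_ge0//; exact: q0'.
Qed.

Lemma mulid_stein_sol_nondecreasing (v w : R) : v <= w -> v * f v <= w * f w.
Proof.
have left (x y : R) : x <= y -> y <= z -> x * f x <= y * f y.
  move=> xy yz; rewrite !f_le//; last exact: le_trans yz.
  by rewrite !(mulrCA _ (1 - _)) ler_wpM2l ?subr_ge0//; exact: mono.
have right (x y : R) : x <= y -> z <= x -> x * f x <= y * f y.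
  move=> xy yz; rewrite !f_ge//; last exact: le_trans yz _.
  rewrite !(mulrCA _ (Phi z)) ler_wpM2l//.
  have := @mono' (- y) (- x); rewrite lerN2 => /(_ xy); lra.
move=> vw; have [wz|zw] := leP w z; first exact: left.
have [vz|zv] := leP v z; last exact: right (ltW _).
exact: le_trans (left _ _ vz (lexx z)) (right _ _ (ltW zw) (lexx z)).
Qed.

(** As [w * f w] is nondecreasing, it suffices to bound it above to the right of [z] and below to
    its left. There the Mills inequality applies, or the sign of [w] settles the case. *)
Lemma mulid_stein_sol_norm (w : R) : `|w * f w| <= 1.
Proof.
have up (y : R) : 0 < y -> y * mills c Psi (- y) <= 1.
  move=> y0; have : - 1 <= - y * mills c Psi (- y).
    by case: HPsi => *; apply: mills_upper => //; lra.
  lra.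
have dn (y : R) : y < 0 -> - 1 <= y * mills c Phi y.
  by move=> y0; case: HPhi => *; exact: mills_upper.
have f0 := stein_sol_ge0.
have upR (y : R) : z <= y -> y * f y <= 1.
  move=> zy; have [y0|y0] := leP y 0.
    by rewrite (le_trans _ ler01)// mulr_le0_ge0.
  by rewrite f_ge// mulrCA mulr_ile1 ?up//; rewrite mulr_ge0// ltW.
have dnL (y : R) : y <= z -> - 1 <= y * f y.
  move=> yz; have [y0|y0] := leP 0 y.
    by rewrite (@le_trans _ _ 0)// ?lerN10// mulr_ge0.
  rewrite f_le// mulrCA; have := dn _ y0 => h.
  have t0 : 0 <= 1 - Phi z by rewrite subr_ge0.
  have := ler_wpM2l t0 h; have := p0; lra.
rewrite ler_norml; apply/andP; split.
  have [wz|zw] := leP w z; first exact: dnL.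
  exact: le_trans (dnL _ (lexx z)) (mulid_stein_sol_nondecreasing (ltW zw)).
have [wz|zw] := leP z w; first exact: upR.
exact: le_trans (mulid_stein_sol_nondecreasing (ltW zw)) (upR _ (lexx z)).
Qed.

Lemma stein_jump_norm (w : R) : `|stein_jump w| <= 1.
Proof. by rewrite /stein_jump ler_norml; have := p0; have := p1; case: (w <= z) => /=; lra. Qed.

Lemma stein_jump_nonincreasing (v w : R) : v <= w -> stein_jump w <= stein_jump v.
Proof.
move=> vw; rewrite /stein_jump lerD2r ler_nat.
by have [wz|_] := leP w z; rewrite ?(le_trans vw wz)//; case: (v <= z).
Qed.

(** The derivative [w * f w + stein_jump w] is the sum of a nondecreasing and a nonincreasing
    function, each estimated at the endpoint where it is extreme. Since [f] has a corner at [z], an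
    interval around [z] is cut there. *)
Lemma stein_sol_increment (v w : R) : v < w ->
  (w - v) * (v * f v + stein_jump w) <= f w - f v
    <= (w - v) * (w * f w + stein_jump v).
Proof.
have left (x y : R) : x < y -> y <= z ->
    (y - x) * (x * f x + (1 - Phi z)) <= f y - f x <= (y - x) * (y * f y + (1 - Phi z)).
  move=> xy yz; rewrite !f_le//; last exact: ltW (lt_le_trans xy yz).
  have /andP[h1 h2] : (y - x) * (1 + x * mills c Phi x) <= mills c Phi y - mills c Phi x
      <= (y - x) * (1 + y * mills c Phi y).
    by case: HPhi => *; exact: mills_increment.
  have z0 : 0 <= 1 - Phi z by rewrite subr_ge0.
  have := ler_wpM2l z0 h1; have := ler_wpM2l z0 h2 => k1 k2.
  by apply/andP; split; lra.
have right (x y : R) : x < y -> z <= x ->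
    (y - x) * (x * f x - Phi z) <= f y - f x <= (y - x) * (y * f y - Phi z).
  move=> xy zx; rewrite !f_ge//; last exact: ltW (le_lt_trans zx xy).
  have /andP[h1 h2] : (- x - - y) * (1 + - y * mills c Psi (- y))
       <= mills c Psi (- x) - mills c Psi (- y)
      <= (- x - - y) * (1 + - x * mills c Psi (- x)).
    by case: HPsi => *; apply: mills_increment => //; rewrite ltrN2.
  have := ler_wpM2l p0 h1; have := ler_wpM2l p0 h2 => k1 k2.
  by apply/andP; split; lra.
move=> vw; rewrite /stein_jump.
have [wz|zw] := leP w z.
  by rewrite (le_trans (ltW vw) wz); exact: left.
have [vz|zv] := leP v z; last first.
  by have := right _ _ vw (ltW zv); rewrite sub0r.
rewrite /= sub0r; have /andP[r1 r2] := right _ _ zw (lexx z).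
have m1 := mulid_stein_sol_nondecreasing vz.
have m2 := mulid_stein_sol_nondecreasing (ltW zw).
move: vz; rewrite le_eqVlt => /predU1P[vz|vz].
  by subst v; apply/andP; split => //; apply: (le_trans r2); nra.
have /andP[l1 l2] := left _ _ vz (lexx z).
by apply/andP; split; nra.
Qed.

(** Outside (-1, 1), [f w] is at most the absolute value of [w * f w], hence at most 1. Inside, the
    increment from -1 has length at most 2 and slope at most 1 + 1, whence 1 + 2 * 2. *)
Lemma stein_sol_le5 (w : R) : f w <= 5.
Proof.
have key (y : R) : 1 <= `|y| -> f y <= 1.
  move=> y1; apply: le_trans (mulid_stein_sol_norm y).
  by rewrite normrM (ger0_norm (stein_sol_ge0 _)) ler_peMl// stein_sol_ge0.
have [/key h|w1] := leP 1 `|w|; first lra.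
have /andP[w2 w3] : -1 < w < 1 by rewrite -ltr_norml.
have f1 : f (-1) <= 1 by apply: key; rewrite normrN normr1.
have /andP[_ h] := stein_sol_increment w2.
have /ler_normlP[_ j1] := mulid_stein_sol_norm w.
have /ler_normlP[_ j2] := stein_jump_norm (-1).
nra.
Qed.

End stein_solution.

(** * Averages over finite product spaces *)

Section finite_average.
Variable R : realType.

Definition avg (T : finType) (f : T -> R) : R := (\sum_t f t) / #|T|%:R.

Lemma eq_avg (T : finType) (f g : T -> R) : f =1 g -> avg f = avg g.
Proof. by move=> fg; congr (_ / _); apply: eq_bigr. Qed.

Lemma avgD (T : finType) (f g : T -> R) : avg (fun t => f t + g t) = avg f + avg g.
Proof. by rewrite /avg big_split mulrDl. Qed.

Lemma avgZ (T : finType) (a : R) (f : T -> R) : avg (fun t => a * f t) = a * avg f.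
Proof. by rewrite /avg -mulr_sumr mulrA. Qed.

Lemma avgZr (T : finType) (a : R) (f : T -> R) : avg (fun t => f t * a) = avg f * a.
Proof. by rewrite mulrC -avgZ; apply: eq_avg => t; rewrite mulrC. Qed.

Lemma avgN (T : finType) (f : T -> R) : avg (fun t => - f t) = - avg f.
Proof. by rewrite -mulN1r -avgZ; apply: eq_avg => t; rewrite mulN1r. Qed.

Lemma avgB (T : finType) (f g : T -> R) : avg (fun t => f t - g t) = avg f - avg g.
Proof. by rewrite avgD avgN. Qed.

Lemma avg_sum (T : finType) (I : Type) (r : seq I) (P : pred I) (F : I -> T -> R) :
  avg (fun t => \sum_(i <- r | P i) F i t) = \sum_(i <- r | P i) avg (F i).
Proof. by rewrite /avg exchange_big mulr_suml. Qed.

Lemma avg_exchange (S T : finType) (F : S -> T -> R) :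
  avg (fun s => avg (fun t => F s t)) = avg (fun t => avg (fun s => F s t)).
Proof.
by rewrite /avg -!mulr_suml exchange_big mulrAC.
Qed.

Lemma avg_reindex (S T : finType) (h : S -> T) (f : T -> R) :
  bijective h -> avg (f \o h) = avg f.
Proof.
move=> hb; rewrite /avg (bij_eq_card hb) [in RHS](reindex h)//.
exact: onW_bij.
Qed.

Lemma ler_avg (T : finType) (f g : T -> R) : (forall t, f t <= g t) -> avg f <= avg g.
Proof.
by move=> fg; rewrite ler_wpM2r ?invr_ge0//; apply: ler_sum => t _.
Qed.

Lemma ler_norm_avg (T : finType) (f : T -> R) : `|avg f| <= avg (fun t => `|f t|).
Proof.
rewrite /avg normrM (ger0_norm (_ : 0 <= #|T|%:R^-1)) ?invr_ge0//.
by rewrite ler_wpM2r ?invr_ge0//; exact: ler_norm_sum.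
Qed.

Lemma avg_ge0 (T : finType) (f : T -> R) : (forall t, 0 <= f t) -> 0 <= avg f.
Proof. by move=> f0; rewrite divr_ge0// sumr_ge0. Qed.

Section nonempty.
Variable T : finType.
Hypothesis T0 : (0 < #|T|)%N.

Lemma avg_cst (a : R) : avg (fun _ : T => a) = a.
Proof.
by rewrite /avg sumr_const -[a *+ _]mulr_natr mulfK// pnatr_eq0 -lt0n.
Qed.

Lemma avg_norm_le (f : T -> R) (a : R) : (forall t, `|f t| <= a) -> `|avg f| <= a.
Proof.
move=> fa; apply: le_trans (ler_norm_avg _) _.
by rewrite -[leRHS]avg_cst; exact: ler_avg.
Qed.

Lemma variance_avg (f : T -> R) :
  avg (fun t => (f t - avg f) ^+ 2) = avg (fun t => f t ^+ 2) - avg f ^+ 2.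
Proof.
set m := avg f.
rewrite (eq_avg (g := fun t => f t ^+ 2 + (- (2 * m)) * f t + m ^+ 2)).
  by rewrite !avgD avgZ avg_cst -/m; lra.
by move=> t; lra.
Qed.

Lemma sqr_avg_le (f : T -> R) : avg f ^+ 2 <= avg (fun t => f t ^+ 2).
Proof.
by rewrite -subr_ge0 -variance_avg; apply: avg_ge0 => t; rewrite sqr_ge0.
Qed.

Lemma avg_norm_sqrt (f : T -> R) (a : R) :
  avg (fun t => f t ^+ 2) <= a -> avg (fun t => `|f t|) <= Num.sqrt a.
Proof.
move=> fa; have h := sqr_avg_le (fun t => `|f t|).
have f0 : 0 <= avg (fun t => `|f t|) by apply: avg_ge0.
rewrite -[leLHS]ger0_norm// -sqrtr_sqr ler_wsqrtr// (le_trans h)//.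
by rewrite (le_trans _ fa)//; apply: ler_avg => t; rewrite real_normK ?num_real.
Qed.

End nonempty.
End finite_average.

(** * Resampling one coordinate; bounded differences *)

Section resampling.
Variables (R : realType) (I T : finType).
Hypothesis T0 : (0 < #|T|)%N.
Implicit Types (V : {ffun I -> T}) (f g : {ffun I -> T} -> R).

Definition upd V (k : I) (t : T) : {ffun I -> T} :=
  [ffun i => if i == k then t else V i].

Lemma upd_same V k t : upd V k t k = t.
Proof. by rewrite ffunE eqxx. Qed.

Lemma upd_neq V k t i : i != k -> upd V k t i = V i.
Proof. by rewrite ffunE => /negbTE->. Qed.

Lemma upd_upd V k s t : upd (upd V k s) k t = upd V k t.
Proof. by apply/ffunP => i; rewrite !ffunE; case: eqP. Qed.

Lemma updC V j k s t : j != k -> upd (upd V j s) k t = upd (upd V k t) j s.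
Proof.
move=> jk; apply/ffunP => i; rewrite !ffunE.
by case: eqVneq => [->|//]; rewrite eq_sym (negbTE jk).
Qed.

Lemma upd_id V k : upd V k (V k) = V.
Proof. by apply/ffunP => i; rewrite ffunE; case: eqP => [->|]. Qed.

Lemma card_ffun_gt0 : (0 < #|{ffun I -> T}|)%N.
Proof. by rewrite card_ffun expn_gt0 T0. Qed.

Let Omega0 := card_ffun_gt0.

(* [(V, upd V k t)] is an exchangeable pair when [V] and [t] are independent and uniform. *)
Lemma avg_upd_exchange (F : {ffun I -> T} -> {ffun I -> T} -> R) k :
  avg (fun V => avg (fun t => F V (upd V k t))) =
  avg (fun V => avg (fun t => F (upd V k t) V)).
Proof.
rewrite /avg -!mulr_suml; congr (_ / _ / _).
rewrite !pair_big/=.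
(* The map from [(V, t)] to [(upd V k t, V k)] is its own inverse and exchanges the two members of
   the pair. *)
rewrite (reindex (fun q : {ffun I -> T} * T => (upd q.1 k q.2, q.1 k)))/=.
  by apply: eq_bigr => -[V t] _; rewrite /= upd_upd upd_id.
exists (fun q : {ffun I -> T} * T => (upd q.1 k q.2, q.1 k)) => -[V t] _ /=;
  by rewrite upd_upd upd_id upd_same.
Qed.

Definition cond_avg k f V : R := avg (fun t => f (upd V k t)).

Definition indep_of k f := forall V t, f (upd V k t) = f V.

Lemma avg_cond_avg k f : avg (cond_avg k f) = avg f.
Proof.
rewrite /cond_avg (avg_upd_exchange (fun _ W => f W)).
by apply: eq_avg => V; rewrite avg_cst.
Qed.

Lemma cond_avg_indep k f : indep_of k (cond_avg k f).
Proof. by move=> V t; apply: eq_avg => s; rewrite upd_upd. Qed.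

Lemma avg_mul_cond_avg k f g : indep_of k g ->
  avg (fun V => g V * f V) = avg (fun V => g V * cond_avg k f V).
Proof.
move=> gk; rewrite -(avg_cond_avg k); apply: eq_avg => V.
by rewrite /cond_avg -avgZ; apply: eq_avg => t; rewrite gk.
Qed.

Lemma avg_mul_eq0 k f g : indep_of k g -> (forall V, cond_avg k f V = 0) ->
  avg (fun V => g V * f V) = 0.
Proof.
move=> gk f0; rewrite (avg_mul_cond_avg _ gk).
under eq_avg do rewrite f0 mulr0.
by rewrite avg_cst.
Qed.

Lemma pythagoras_cond_avg k f : avg (fun V => f V ^+ 2) =
  avg (fun V => (f V - cond_avg k f V) ^+ 2) + avg (fun V => cond_avg k f V ^+ 2).
Proof.
have h : avg (fun V => cond_avg k f V * f V) = avg (fun V => cond_avg k f V ^+ 2).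
  by rewrite (avg_mul_cond_avg f (@cond_avg_indep k f)).
rewrite [X in _ = X + _](_ : _ = avg (fun V => f V ^+ 2)
    - 2 * avg (fun V => cond_avg k f V * f V) + avg (fun V => cond_avg k f V ^+ 2)).
  by rewrite h; lra.
by rewrite -avgZ -avgB -avgD; apply: eq_avg => V; lra.
Qed.

Definition bounded_diff f (c : R) := forall V k t, `|f V - f (upd V k t)| <= c.

Lemma bounded_diff_cond_avg k f c : bounded_diff f c -> bounded_diff (cond_avg k f) c.
Proof.
move=> fc V j t; have [->|jk] := eqVneq j k.
  rewrite cond_avg_indep subrr normr0.
  by apply: le_trans (fc V k t); rewrite normr_ge0.
rewrite /cond_avg -avgB; apply: avg_norm_le => // s.
by rewrite updC.
Qed.

Lemma indep_of_cond_avg j k f : indep_of k f -> indep_of k (cond_avg j f).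
Proof.
move=> fk; have [<-|jk] := eqVneq j k; first exact: cond_avg_indep.
move=> V t; apply: eq_avg => s.
by rewrite -updC// fk.
Qed.

Lemma indep_of_all_cst f : (forall k, indep_of k f) -> forall V, f V = avg f.
Proof.
move=> fk V; rewrite -[LHS](avg_cst card_ffun_gt0); apply: eq_avg => W.
(* [W] turns into [V] by overwriting one coordinate after another, none of which [f] sees. *)
have -> : V = foldr (fun k U => upd U k (V k)) W (enum I).
  apply/ffunP => i.
  have : i \in enum I by rewrite mem_enum.
  elim: (enum I) => //= j s IH; rewrite in_cons ffunE.
  by case: eqVneq => [->//|_ /=] /IH.
by elim: (enum I) => //= j s IH; rewrite fk.
Qed.

(** Coordinates are averaged out one at a time. By Pythagoras each averaging lowers the second
    moment by at most [c ^+ 2], and it preserves bounded differences; in the end only the constant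
    [avg f] is left. *)
Lemma variance_bounded_diff f c : bounded_diff f c ->
  avg (fun V => (f V - avg f) ^+ 2) <= #|I|%:R * c ^+ 2.
Proof.
move=> fc; rewrite variance_avg ?card_ffun_gt0//.
pose g s := foldr cond_avg f s.
have gc s : bounded_diff (g s) c.
  by elim: s => //= k s IH; exact: bounded_diff_cond_avg.
have gs s : avg (fun V => f V ^+ 2) <=
    (size s)%:R * c ^+ 2 + avg (fun V => g s V ^+ 2).
  elim: s => [|k s IH] /=; first by rewrite mul0r add0r.
  apply: (le_trans IH); rewrite (pythagoras_cond_avg k (g s)) -natr1.
  rewrite mulrDl mul1r -!addrA lerD2l lerD2r.
  rewrite -[leRHS](avg_cst card_ffun_gt0); apply: ler_avg => V.
  rewrite -[leLHS]real_normK ?num_real// lerXn2r ?nnegrE//.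
    by apply: le_trans (gc s V k (V k)).
  have -> : g s V - cond_avg k (g s) V = avg (fun t => g s V - g s (upd V k t)).
    by rewrite avgB avg_cst.
  by apply: avg_norm_le => // t; exact: gc.
have gk s k : k \in s -> indep_of k (g s).
  elim: s => //= j s IH; rewrite in_cons => /predU1P[->|/IH h].
    exact: cond_avg_indep.
  exact: indep_of_cond_avg.
have avgg s : avg (g s) = avg f.
  by elim: s => //= k s <-; rewrite avg_cond_avg.
have := gs (enum I); rewrite -cardE lerBlDr => /le_trans; apply.
rewrite lerD2l (_ : avg _ = avg f ^+ 2)// -[RHS](avg_cst card_ffun_gt0).
apply: eq_avg => V; rewrite (@indep_of_all_cst (g (enum I))) ?avgg// => k.
by apply: gk; rewrite mem_enum.
Qed.

End resampling.

(** * Exchangeable pairs *)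

Section exchangeable_pair.
Variables (R : realType) (c : R) (Phi : R -> R).
Hypothesis HPhi : gauss_cdf c Phi.

(* [w * f w] is nondecreasing and [stein_jump] nonincreasing, so the increment of the Stein
   solution over an interval is controlled by their values at the two endpoints only. *)
Lemma stein_sol_remainder (z w v : R) (d := w - v) (f := stein_sol c Phi z)
    (b := stein_jump Phi z) :
  `|d ^+ 2 * (w * f w + b w) - d * (f w - f v)| <=
  d * `|d| * ((w * f w - b w) - (v * f v - b v)).
Proof.
have [vw|wv|vw] := ltgtP v w; last first.
- have -> : d = 0 by rewrite /d vw subrr.
  by rewrite expr0n/= !mul0r subrr normr0.
- have d0 : d < 0 by rewrite subr_lt0.
  have /andP[h1 h2] := stein_sol_increment z HPhi wv.
  have a1 := mulid_stein_sol_nondecreasing z HPhi (ltW wv).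
  have b1 := stein_jump_nonincreasing Phi z (ltW wv).
  have -> : d = - (v - w) by rewrite opprB.
  have e0 : 0 < v - w by rewrite subr_gt0.
  set e := v - w in h1 h2 e0 *.
  rewrite -/f -/b in h1 h2 a1 b1.
  have k1 := ler_wpM2l (ltW e0) h1; have k2 := ler_wpM2l (ltW e0) h2.
  have dd : 0 <= e * e by rewrite mulr_ge0 ?ltW.
  have a2 := ler_wpM2l dd a1; have b2 := ler_wpM2l dd b1.
  rewrite normrN (gtr0_norm e0) ler_norml; apply/andP; split; lra.
- have d0 : 0 < d by rewrite subr_gt0.
  have /andP[h1 h2] := stein_sol_increment z HPhi vw.
  have a1 := mulid_stein_sol_nondecreasing z HPhi (ltW vw).
  have b1 := stein_jump_nonincreasing Phi z (ltW vw).
  rewrite -/f -/b -/d in h1 h2 a1 b1.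
  have k1 := ler_wpM2l (ltW d0) h1; have k2 := ler_wpM2l (ltW d0) h2.
  have dd : 0 <= d * d by rewrite mulr_ge0 ?ltW.
  have a2 := ler_wpM2l dd a1; have b2 := ler_wpM2l dd b1.
  rewrite (gtr0_norm d0) ler_norml; apply/andP; split; lra.
Qed.

Variables (I T : finType).
Hypothesis T0 : (0 < #|T|)%N.
Implicit Types (V : {ffun I -> T}).

Definition resampling_sum (F : {ffun I -> T} -> {ffun I -> T} -> R) V : R :=
  \sum_k avg (fun t => F V (upd V k t)).

Lemma avg_resampling_sum_swap F :
  avg (resampling_sum F) = avg (resampling_sum (fun V W => F W V)).
Proof. by rewrite /resampling_sum !avg_sum; apply: eq_bigr => k _; exact: avg_upd_exchange. Qed.

(** Exchanging the pair turns [F V W * g W] into [- F V W * g V], so both halves of the difference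
    contribute equally. *)
Lemma avg_resampling_sum_antisym (F : {ffun I -> T} -> {ffun I -> T} -> R)
    (g : {ffun I -> T} -> R) :
  (forall V W, F W V = - F V W) ->
  avg (resampling_sum (fun V W => F V W * (g V - g W))) =
  2 * avg (fun V => g V * resampling_sum F V).
Proof.
move=> Fas.
have e : avg (fun V => g V * resampling_sum F V) =
         avg (resampling_sum (fun V W => F V W * g V)).
  apply: eq_avg => V; rewrite /resampling_sum mulr_sumr; apply: eq_bigr => k _.
  by rewrite -avgZ; apply: eq_avg => t; rewrite mulrC.
have e2 : avg (resampling_sum (fun V W => F V W * g W)) =
         - avg (resampling_sum (fun V W => F V W * g V)).
  rewrite avg_resampling_sum_swap -avgN; apply: eq_avg => V.
  rewrite /resampling_sum -sumrN; apply: eq_bigr => k _.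
  by rewrite -avgN; apply: eq_avg => t; rewrite Fas mulNr.
transitivity (avg (resampling_sum (fun V W => F V W * g V)) -
              avg (resampling_sum (fun V W => F V W * g W))).
  rewrite -avgB; apply: eq_avg => V.
  rewrite /resampling_sum -sumrB; apply: eq_bigr => k _.
  by rewrite -avgB; apply: eq_avg => t; rewrite mulrBr.
by rewrite e2 e; lra.
Qed.

(** Summing over the resampled coordinate, instead of choosing it at random, absorbs the factor n.
    The factors 2 come from the bounds 1 on [w * f w] and on the jump, the factor 5 from the bound
    on [f]. *)
Theorem exchangeable_pair_bound (W : {ffun I -> T} -> R) (z : R) :
  `|avg (fun V => (W V <= z)%R%:R) - Phi z| <=
  2 * avg (fun V => `|1 - resampling_sum (fun V V' => (W V - W V') ^+ 2) V / 2|)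
  + 2 * avg (fun V => `|resampling_sum (fun V V' => (W V - W V') * `|W V - W V'|) V|)
  + 5 * avg (fun V => `|resampling_sum (fun V V' => W V - W V') V - W V|).
Proof.
pose f := stein_sol c Phi z; pose b := stein_jump Phi z.
set A2 := resampling_sum (fun V V' => (W V - W V') ^+ 2).
set A3 := resampling_sum (fun V V' => (W V - W V') * `|W V - W V'|).
set A1 := resampling_sum (fun V V' => W V - W V').
have O0 : (0 < #|{ffun I -> T}|)%N by exact: card_ffun_gt0.
have fa w : `|w * f w| <= 1 by exact: mulid_stein_sol_norm.
have fb w : `|b w| <= 1 by apply: stein_jump_norm; exact HPhi.
have f5 w : `|f w| <= 5 by rewrite ger0_norm ?stein_sol_ge0// stein_sol_le5.
have e1 : avg (fun V => f (W V) * A1 V) =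
    2^-1 * avg (resampling_sum (fun V V' => (W V - W V') * (f (W V) - f (W V')))).
  rewrite (@avg_resampling_sum_antisym _ (f \o W)); first by lra.
  by move=> V V'; rewrite opprB.
(* Stein's equation is averaged; by [e1], [f (W V) * A1 V] averages to half the sum of
   [(W - W') (f W - f W')]. Replacing each increment of [f] by its linearisation at [W V] leaves the
   three errors. *)
have e2 : avg (fun V => (W V <= z)%R%:R) - Phi z =
  avg (fun V => (W V * f (W V) + b (W V)) * (1 - A2 V / 2))
  + 2^-1 * avg (resampling_sum (fun V V' => (W V - W V') ^+ 2 * (W V * f (W V) + b (W V))
        - (W V - W V') * (f (W V) - f (W V'))))
  + avg (fun V => (A1 V - W V) * f (W V)).
  have -> : avg (resampling_sum (fun V V' => (W V - W V') ^+ 2 * (W V * f (W V) + b (W V))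
        - (W V - W V') * (f (W V) - f (W V'))))
    = avg (fun V => A2 V * (W V * f (W V) + b (W V))) -
      avg (resampling_sum (fun V V' => (W V - W V') * (f (W V) - f (W V')))).
    rewrite -avgB; apply: eq_avg => V.
    rewrite /A2 /resampling_sum mulr_suml -sumrB; apply: eq_bigr => k _.
    by rewrite -avgZr -avgB.
  rewrite mulrBr -e1 -avgZ -avgB -!avgD.
  rewrite -[X in _ - X](avg_cst O0) -avgB; apply: eq_avg => V.
  by rewrite -[LHS]/(b (W V)); lra.
rewrite e2; apply: (le_trans (ler_normD _ _)); apply: lerD; last first.
  apply: (le_trans (ler_norm_avg _)); rewrite -avgZ; apply: ler_avg => V.
  by rewrite normrM mulrC ler_wpM2r.
apply: (le_trans (ler_normD _ _)); apply: lerD.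
  apply: (le_trans (ler_norm_avg _)); rewrite -avgZ; apply: ler_avg => V.
  rewrite normrM ler_wpM2r//; apply: (le_trans (ler_normD _ _)).
  by have := fa (W V); have := fb (W V); lra.
rewrite normrM ger0_norm ?invr_ge0//.
apply: (@le_trans _ _ (2^-1 * avg (resampling_sum (fun V V' =>
     (W V - W V') * `|W V - W V'| *
     ((W V * f (W V) - b (W V)) - (W V' * f (W V') - b (W V'))))))).
  rewrite ler_wpM2l ?invr_ge0//; apply: (le_trans (ler_norm_avg _)).
  apply: ler_avg => V; apply: (le_trans (ler_norm_sum _ _ _)).
  apply: ler_sum => k _; apply: (le_trans (ler_norm_avg _)).
  by apply: ler_avg => t; exact: stein_sol_remainder.
(* The remainder bound is an antisymmetric factor times an increment, so exchangeability reduces it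
   to values at [V] against [A3]. The cancellations inside [A3], lost with a cubic absolute moment,
   are kept. *)
rewrite (@avg_resampling_sum_antisym (fun V V' => (W V - W V') * `|W V - W V'|)
  (fun V => W V * f (W V) - b (W V))); last first.
  by move=> V V'; rewrite distrC -mulNr opprB.
rewrite mulrA mulVf ?pnatr_eq0// mul1r -/A3.
apply: (le_trans (ler_norm _)); apply: (le_trans (ler_norm_avg _)).
rewrite -avgZ; apply: ler_avg => V; rewrite normrM ler_wpM2r//.
apply: (le_trans (ler_normB _ _)).
by have := fa (W V); have := fb (W V); lra.
Qed.

End exchangeable_pair.

(** * U-statistics of order two *)

Section u_statistic.
Variables (R : realType) (I T : finType).
Hypothesis T0 : (0 < #|T|)%N.
Variables (h : T -> T -> R) (K : R).
Hypothesis h_sym : forall u v, h u v = h v u.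
Hypothesis h_ge0 : forall u v, 0 <= h u v.
Hypothesis h_le : forall u v, h u v <= K.
Hypothesis I0 : (0 < #|I|)%N.
Implicit Types (V : {ffun I -> T}).

Local Notation n := (#|I|%:R : R).
Let O0 : (0 < #|{ffun I -> T}|)%N. Proof. exact: card_ffun_gt0. Qed.

Definition ustat V : R := 2^-1 * \sum_i \sum_(j | j != i) h (V i) (V j).
Local Notation X := ustat.

Definition ustat_proj (v : T) : R := avg (fun t => h v t).
Local Notation h1 := ustat_proj.

Definition ustat_proj_mean : R := avg h1.
Local Notation m0 := ustat_proj_mean.

Definition ustat_proj_var : R := avg (fun v => (h1 v - m0) ^+ 2).

(** The second-order component of [h] in Hoeffding's decomposition: it averages to 0 in either
    argument. *)
Definition ustat_degen (u v : T) : R := h u v - h1 u - h1 v + m0.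
Local Notation hh := ustat_degen.

Let D V := 2^-1 * \sum_i \sum_(j | j != i) hh (V i) (V j).
Let G V := \sum_i (h1 (V i) - m0).

Lemma sum_cst (a : R) : \sum_(i : I) a = n * a.
Proof. by rewrite sumr_const mulr_natl. Qed.

Let K0 : 0 <= K.
Proof.
by have /card_gt0P[t _] := T0; exact: le_trans (h_ge0 t t) (h_le t t).
Qed.

Lemma sum_offdiag (F : I -> I -> R) (k : I) :
  \sum_i \sum_(j | j != i) F i j =
  \sum_(j | j != k) (F k j + F j k) + \sum_(i | i != k) \sum_(j | (j != i) && (j != k)) F i j.
Proof.
rewrite (bigD1 k)//= big_split/= -!addrA; congr (_ + _).
rewrite -big_split/=; apply: eq_bigr => i ik.
by rewrite (bigD1 k)/= 1?eq_sym//; rewrite eq_sym.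
Qed.

Lemma ustat_resample V k t : X V - X (upd V k t) =
  \sum_(j | j != k) (h (V k) (V j) - h t (V j)).
Proof.
rewrite /X -mulrBr !(sum_offdiag _ k).
rewrite opprD addrACA [X in _ + X](_ : _ = 0) ?addr0; last first.
  apply/eqP; rewrite subr_eq0; apply/eqP; apply: eq_bigr => i ik.
  by apply: eq_bigr => j /andP[_ jk]; rewrite !upd_neq.
rewrite -sumrB mulr_sumr; apply: eq_bigr => j jk.
rewrite upd_same upd_neq// (h_sym (V j)) (h_sym (V j) t); lra.
Qed.

Let hK u v w : `|h u v - h w v| <= K.
Proof.
have := h_ge0 u v; have := h_le u v; have := h_ge0 w v; have := h_le w v.
by rewrite ler_norml => *; apply/andP; split; lra.
Qed.

Lemma sum_neq_le (k : I) (F : I -> R) (a : R) : 0 <= a ->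
  (forall j, F j <= a) -> \sum_(j | j != k) F j <= n * a.
Proof.
move=> a0 Fa; apply: (@le_trans _ _ (\sum_(j : I) a)).
  rewrite big_mkcond/=; apply: ler_sum => j _.
  by case: ifP.
by rewrite sum_cst.
Qed.

Lemma ustat_resample_norm V k t : `|X V - X (upd V k t)| <= n * K.
Proof.
rewrite ustat_resample; apply: (le_trans (ler_norm_sum _ _ _)).
exact: sum_neq_le.
Qed.

Lemma ustat_resample_bounded_diff V k t i s : i != k ->
  `|(X V - X (upd V i s)) - (X (upd V k t) - X (upd (upd V k t) i s))| <= 2 * K.
Proof.
move=> ik; rewrite !ustat_resample -sumrB (bigD1 k) 1?eq_sym//=.
rewrite big1 ?addr0; last first.
  by move=> j /andP[ji jk]; rewrite !upd_neq// subrr.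
rewrite upd_same upd_neq//.
apply: (le_trans (ler_normB _ _)).
by have := hK (V i) (V k) s; have := hK (V i) t s; lra.
Qed.

Section second_order.
Variable psi : R -> R.
Hypothesis psi_lip : forall x y, `|psi x - psi y| <= `|x - y| * (`|x| + `|y|).
Hypothesis psi0 : psi 0 = 0.

Let Q := resampling_sum (fun V W => psi (X V - X W)).

(** [psi] stands for the square and the signed square. The term of [k] itself changes by at most
    [2 * (n * K) ^+ 2]. For [i != k] only the kernel term joining [i] and [k] is affected: the
    increment, of size at most [n * K], moves by at most [2 * K], so its image under [psi] moves by
    at most [4 * n * K ^+ 2], for at most [n] such [i]. *)
Lemma resampling_sum_bounded_diff : bounded_diff Q (6 * n ^+ 2 * K ^+ 2).
Proof.
move=> V k t; rewrite /Q /resampling_sum -sumrB.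
apply: (le_trans (ler_norm_sum _ _ _)).
have psiK U i s : `|psi (X U - X (upd U i s))| <= (n * K) ^+ 2.
  have := psi_lip (X U - X (upd U i s)) 0; rewrite psi0 !subr0 normr0 addr0.
  move=> /le_trans; apply; rewrite -expr2.
  by rewrite lerXn2r ?nnegrE ?mulr_ge0//; exact: ustat_resample_norm.
rewrite (bigD1 k)//=.
have n1 : 1 <= n by rewrite ler1n.
apply: (@le_trans _ _ (2 * (n * K) ^+ 2 + n * (4 * n * K ^+ 2))); last first.
  by lra.
apply: lerD.
  rewrite -avgB; apply: (avg_norm_le T0) => s.
  by apply: (le_trans (ler_normB _ _)); rewrite mulr_natl mulr2n lerD.
rewrite big_mkcond/=; apply: (@le_trans _ _ (\sum_(j : I) (4 * n * K ^+ 2))); last first.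
  by rewrite sum_cst.
apply: ler_sum => i _; case: ifP => ik; last by rewrite !mulr_ge0 ?sqr_ge0.
rewrite -avgB; apply: (avg_norm_le T0) => s.
apply: (le_trans (psi_lip _ _)).
have a1 := ustat_resample_bounded_diff V t s ik.
have a2 := ustat_resample_norm V i s.
have a3 := ustat_resample_norm (upd V k t) i s.
apply: (@le_trans _ _ (2 * K * (n * K + n * K))); last by lra.
by rewrite ler_pM ?addr_ge0 ?lerD.
Qed.

Lemma resampling_sum_variance :
  avg (fun V => (Q V - avg Q) ^+ 2) <= n * (6 * n ^+ 2 * K ^+ 2) ^+ 2.
Proof. exact: variance_bounded_diff resampling_sum_bounded_diff. Qed.

End second_order.

Lemma avg_coord (i : I) (f : T -> R) : avg (fun V => f (V i)) = avg f.
Proof.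
rewrite -(avg_cond_avg T0 i) -[RHS](avg_cst O0); apply: eq_avg => V.
by apply: eq_avg => t; rewrite upd_same.
Qed.

Lemma cond_avg_degenr i j V : i != j -> cond_avg j (fun U => hh (U i) (U j)) V = 0.
Proof.
move=> ij; rewrite /cond_avg.
rewrite (eq_avg (g := fun t => (h (V i) t - h1 (V i)) - (h1 t - m0))).
  by rewrite !avgB !(avg_cst T0) -/(h1 (V i)) -/m0 !subrr ?subr0.
by move=> t; rewrite upd_same upd_neq// /hh; lra.
Qed.

Lemma degen_sym u v : hh u v = hh v u.
Proof. by rewrite /hh h_sym; lra. Qed.

Lemma cond_avg_degenl i j V : i != j -> cond_avg i (fun U => hh (U i) (U j)) V = 0.
Proof.
move=> ij; rewrite -(@cond_avg_degenr j i V) 1?eq_sym//.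
by apply: eq_avg => t; rewrite degen_sym.
Qed.

Lemma degen_orth i j (g : {ffun I -> T} -> R) : i != j ->
  indep_of i g \/ indep_of j g -> avg (fun V => g V * hh (V i) (V j)) = 0.
Proof.
move=> ij [gi|gj].
  by apply: (avg_mul_eq0 T0 gi) => V; exact: cond_avg_degenl.
by apply: (avg_mul_eq0 T0 gj) => V; exact: cond_avg_degenr.
Qed.

Lemma indep_of_coord (k i : I) (f : T -> R) : i != k -> indep_of k (fun V => f (V i)).
Proof. by move=> ik V t; rewrite upd_neq. Qed.

Lemma indep_of_coord2 (k i j : I) (f : T -> T -> R) : i != k -> j != k ->
  indep_of k (fun V => f (V i) (V j)).
Proof. by move=> ik jk V t; rewrite !upd_neq. Qed.

Let h1K u : 0 <= h1 u <= K.
Proof.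
apply/andP; split; first exact: avg_ge0.
by rewrite -(avg_cst T0 K); apply: ler_avg.
Qed.

Let m0K : 0 <= m0 <= K.
Proof.
apply/andP; split; first by apply: avg_ge0 => u; case/andP: (h1K u).
by rewrite -(avg_cst T0 K); apply: ler_avg => u; case/andP: (h1K u).
Qed.

Lemma degen_norm u v : `|hh u v| <= 2 * K.
Proof.
have /andP[a1 a2] := h1K u; have /andP[b1 b2] := h1K v; have /andP[m1 m2] := m0K.
have := h_ge0 u v; have := h_le u v.
by rewrite ler_norml /hh => *; apply/andP; split; lra.
Qed.

Lemma sum_offdiagl (F : I -> R) : \sum_i \sum_(j | j != i) F i = (n - 1) * \sum_i F i.
Proof.
rewrite mulr_sumr; apply: eq_bigr => i _.
rewrite sumr_const -[_ *+ _]mulr_natl; congr (_ * _).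
have -> : #|(fun j => j != i)| = #|I|.-1.
  by rewrite -(cardC1 i); apply: eq_card => j; rewrite !inE.
by rewrite -subn1 natrB.
Qed.

Lemma sum_offdiagr (F : I -> R) : \sum_i \sum_(j | j != i) F j = (n - 1) * \sum_i F i.
Proof.
rewrite -sum_offdiagl (exchange_big_dep predT)//=.
by apply: eq_bigr => i _; apply: eq_bigl => j; rewrite eq_sym.
Qed.

Lemma avg_coord2 (i j : I) (f : T -> T -> R) : i != j ->
  avg (fun V => f (V i) (V j)) = avg (fun u => avg (fun v => f u v)).
Proof.
move=> ij; rewrite -(avg_cond_avg T0 j) -(avg_coord i (fun u => avg (f u))).
by apply: eq_avg => V; apply: eq_avg => t; rewrite upd_same upd_neq.
Qed.

Definition ustat_degen_var : R := avg (fun u => avg (fun v => hh u v ^+ 2)).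
Local Notation omega := ustat_degen_var.

Lemma avg_degen_sqrE : avg (fun V => D V ^+ 2) = 2^-1 * (n * (n - 1) * omega).
Proof.
pose E i j k l := avg (fun V => hh (V k) (V l) * hh (V i) (V j)).
(* Degeneracy kills every product in which some index occurs only once; [(k, l)] must be [(i, j)] or
   [(j, i)]. *)
have E0 i j k l : j != i -> l != k -> ~~ ((k == i) && (l == j) || (k == j) && (l == i)) ->
    E i j k l = 0.
  move=> ji lk kl; apply: degen_orth; first by rewrite eq_sym.
  have [ki|ki] := eqVneq k i.
    right; apply: indep_of_coord2; first by rewrite ki eq_sym.
    by apply: contraNneq kl => ->; rewrite ki !eqxx.
  have [li|li] := eqVneq l i; last by left; exact: indep_of_coord2.
  right; apply: indep_of_coord2; last by rewrite li eq_sym.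
  by apply: contraNneq kl => ->; rewrite li !eqxx orbT.
have Ed i j : j != i -> E i j i j = omega.
  by move=> ji; rewrite -[RHS](@avg_coord2 i j (fun u v => hh u v ^+ 2)) 1?eq_sym.
have Es i j : j != i -> E i j j i = omega.
  move=> ji; rewrite -(Ed _ _ ji).
  by apply: eq_avg => V; rewrite (degen_sym (V j)).
have -> : avg (fun V => D V ^+ 2) =
    4^-1 * \sum_i \sum_(j | j != i) \sum_k \sum_(l | l != k) E i j k l.
  transitivity (4^-1 * avg (fun V => \sum_i \sum_(j | j != i) \sum_k \sum_(l | l != k)
     (hh (V k) (V l) * hh (V i) (V j)))).
    rewrite -avgZ; apply: eq_avg => V; rewrite /D exprMn exprVn.
    congr (_ * _); first by congr (_^-1); lra.
    rewrite expr2 mulr_suml; apply: eq_bigr => i _.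
    rewrite mulr_suml; apply: eq_bigr => j _.
    rewrite mulr_sumr; apply: eq_bigr => k _.
    by rewrite mulr_sumr; apply: eq_bigr => l _; rewrite mulrC.
  congr (_ * _); rewrite avg_sum; apply: eq_bigr => i _.
  rewrite avg_sum; apply: eq_bigr => j _.
  rewrite avg_sum; apply: eq_bigr => k _.
  by rewrite avg_sum.
transitivity (4^-1 * \sum_(i : I) \sum_(j | j != i) (2 * omega)); last first.
  by rewrite sum_offdiagl sum_cst; lra.
congr (_ * _); apply: eq_bigr => i _; apply: eq_bigr => j ji.
transitivity (\sum_k \sum_l (((k == i) && (l == j))%:R * omega +
       ((k == j) && (l == i))%:R * omega)).
  apply: eq_bigr => k _; rewrite big_mkcond/=; apply: eq_bigr => l _.
  have [lk|/negPn/eqP ->] := ifP; last first.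
    have [->|] := eqVneq k i; last by rewrite andbF/= !mul0r addr0.
    by rewrite eq_sym (negbTE ji)/= !mul0r addr0.
  have [/andP[/eqP-> /eqP->]|kl] := boolP ((k == i) && (l == j)).
    by rewrite Ed// mul1r eq_sym (negbTE ji) mul0r addr0.
  have [/andP[/eqP-> /eqP->]|kl'] := boolP ((k == j) && (l == i)).
    by rewrite Es// mul1r mul0r add0r.
  by rewrite E0 ?negb_or ?kl// !mul0r addr0.
under eq_bigr do rewrite big_split/= -!mulr_suml.
rewrite big_split/= -!mulr_suml.
have one (a b : I) : \sum_k \sum_l ((k == a) && (l == b))%:R = 1 :> R.
  rewrite (bigD1 a)//= (bigD1 b)//= !eqxx/= big1 ?addr0.
    by rewrite big1 ?addr0// => k ka; rewrite big1// => l _; rewrite (negbTE ka).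
  by move=> l lb; rewrite (negbTE lb).
by rewrite !one; lra.
Qed.

Lemma avg_degen_sqr : avg (fun V => D V ^+ 2) <= 2 * n ^+ 2 * K ^+ 2.
Proof.
have w4 : omega <= 4 * K ^+ 2.
  rewrite -[leRHS](avg_cst T0); apply: ler_avg => u.
  rewrite -[leRHS](avg_cst T0); apply: ler_avg => v.
  rewrite (_ : 4 * K ^+ 2 = (2 * K) ^+ 2); last by lra.
  by rewrite -[leLHS]real_normK ?num_real// lerXn2r ?nnegrE ?mulr_ge0// degen_norm.
have w0 : 0 <= omega by apply: avg_ge0 => u; apply: avg_ge0 => v; exact: sqr_ge0.
rewrite avg_degen_sqrE.
have n1 : 1 <= n by rewrite ler1n.
have nn : n * (n - 1) <= n * n by rewrite ler_wpM2l//; lra.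
have nn0 : 0 <= n * (n - 1) by rewrite mulr_ge0 ?subr_ge0.
have := ler_pM nn0 w0 nn w4; lra.
Qed.

Lemma ustat_mean : avg X = 2^-1 * (n * (n - 1) * m0).
Proof.
rewrite /X avgZ; congr (_ * _); rewrite avg_sum.
have -> : n * (n - 1) * m0 = \sum_(i : I) (n - 1) * m0.
  by rewrite sum_cst mulrA.
apply: eq_bigr => i _; rewrite avg_sum.
transitivity (\sum_(j | j != i) m0).
  apply: eq_bigr => j ji; rewrite -[RHS](avg_coord i h1) -(avg_cond_avg T0 j).
  by apply: eq_avg => V; apply: eq_avg => t; rewrite upd_same upd_neq// eq_sym.
rewrite sumr_const -[_ *+ _]mulr_natl; congr (_ * _).
have -> : #|(fun j => j != i)| = #|I|.-1.
  by rewrite -(cardC1 i); apply: eq_card => j; rewrite !inE.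
by rewrite -subn1 natrB.
Qed.

Lemma ustat_decomp V : X V - avg X = (n - 1) * G V + D V.
Proof.
rewrite ustat_mean /D /G.
have -> : \sum_i \sum_(j | j != i) hh (V i) (V j) =
    2 * X V - (n - 1) * \sum_i h1 (V i) - (n - 1) * \sum_i h1 (V i) + (n - 1) * (n * m0).
  have -> : 2 * X V = \sum_i \sum_(j | j != i) h (V i) (V j).
    by rewrite /X mulrA divff ?pnatr_eq0// mul1r.
  rewrite -{1}sum_offdiagl -sum_offdiagr.
  have -> : n * m0 = \sum_(i : I) m0 by rewrite sum_cst.
  rewrite -sum_offdiagl -!sumrB -big_split/=; apply: eq_bigr => i _.
  by rewrite -!sumrB -big_split.
rewrite sumrB sum_cst; lra.
Qed.

(** Resampling multiplies a Hoeffding component by its order: 1 for the linear part, 2 for the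
    degenerate part, where either index of a pair may be resampled. The remainder in the linearity
    condition is thus exactly [D]. *)
Lemma resampling_sum_ustat V :
  resampling_sum (fun U W => X U - X W) V = (X V - avg X) + D V.
Proof.
have -> : X V - avg X + D V = 2 * (X V - avg X) - (n - 1) * G V.
  by rewrite ustat_decomp; lra.
rewrite ustat_mean /G sumrB sum_cst.
transitivity (\sum_k \sum_(j | j != k) (h (V k) (V j) - h1 (V j))).
  apply: eq_bigr => k _.
  under eq_avg do rewrite ustat_resample.
  rewrite avg_sum; apply: eq_bigr => j _.
  rewrite avgB (avg_cst T0); congr (_ - _).
  by apply: eq_avg => t; rewrite h_sym.
under eq_bigr do rewrite sumrB.
rewrite sumrB sum_offdiagr /X; lra.
Qed.

Let GD : avg (fun V => G V * D V) = 0.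
Proof.
rewrite (eq_avg (g := fun V => 2^-1 * \sum_i \sum_(j | j != i) \sum_k
   ((h1 (V k) - m0) * hh (V i) (V j)))).
  rewrite avgZ avg_sum big1 ?mulr0// => i _; rewrite avg_sum big1// => j ji.
  rewrite avg_sum big1// => k _; apply: degen_orth; first by rewrite eq_sym.
  have [ki|ki] := eqVneq k i; last by left; apply: (@indep_of_coord _ _ (fun v => h1 v - m0)).
  right; apply: (@indep_of_coord _ _ (fun v => h1 v - m0)).
  by rewrite ki eq_sym.
move=> V; rewrite /G /D mulrCA; congr (_ * _).
rewrite mulr_sumr; apply: eq_bigr => i _; rewrite mulr_sumr; apply: eq_bigr => j _.
by rewrite mulr_suml.
Qed.

Let GG : avg (fun V => G V ^+ 2) = n * ustat_proj_var.
Proof.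
rewrite (eq_avg (g := fun V => \sum_i \sum_j ((h1 (V j) - m0) * (h1 (V i) - m0)))); last first.
  by move=> V; rewrite expr2 /G mulr_sumr; apply: eq_bigr => i _; rewrite mulr_suml.
rewrite avg_sum.
have -> : n * ustat_proj_var = \sum_(i : I) ustat_proj_var.
  by rewrite sum_cst.
apply: eq_bigr => i _; rewrite avg_sum (bigD1 i)//= big1 ?addr0.
  by rewrite /ustat_proj_var -(avg_coord i (fun v => (h1 v - m0) ^+ 2)).
move=> j ji; apply: (avg_mul_eq0 T0 (k := i)).
  exact: (@indep_of_coord _ _ (fun v => h1 v - m0)).
move=> V; rewrite /cond_avg.
under eq_avg do rewrite upd_same.
by rewrite avgB (avg_cst T0) subrr.
Qed.

Definition ustat_var : R := avg (fun V => (X V - avg X) ^+ 2).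

Let ustat_varE : ustat_var = (n - 1) ^+ 2 * n * ustat_proj_var + avg (fun V => D V ^+ 2).
Proof.
rewrite -mulrA -GG.
transitivity ((n - 1) ^+ 2 * avg (fun V => G V ^+ 2)
   + 2 * (n - 1) * avg (fun V => G V * D V) + avg (fun V => D V ^+ 2)).
  rewrite -!avgZ -!avgD; apply: eq_avg => V; rewrite ustat_decomp; lra.
by rewrite GD; lra.
Qed.

(** Meant for the chord kernel on the [r] points of one copy: its projection is constant, so the
    degenerate term is the whole variance. *)
Lemma ustat_var_decomp :
  ustat_var = (n - 1) ^+ 2 * n * ustat_proj_var + 2^-1 * (n * (n - 1) * omega).
Proof. by rewrite ustat_varE avg_degen_sqrE. Qed.

Lemma ustat_var_ge : (n - 1) ^+ 2 * n * ustat_proj_var <= ustat_var.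
Proof.
by rewrite ustat_varE lerDl; apply: avg_ge0 => V; exact: sqr_ge0.
Qed.

Let XD : avg (fun V => (X V - avg X) * D V) = avg (fun V => D V ^+ 2).
Proof.
transitivity ((n - 1) * avg (fun V => G V * D V) + avg (fun V => D V ^+ 2)).
  by rewrite -avgZ -avgD; apply: eq_avg => V; rewrite ustat_decomp; lra.
by rewrite GD mulr0 add0r.
Qed.

Let Q2 := resampling_sum (fun V W : {ffun I -> T} => (X V - X W) ^+ 2).
Let Q3 := resampling_sum (fun V W : {ffun I -> T} => (X V - X W) * `|X V - X W|).

(** By antisymmetry this is twice the covariance of [X] with its own resampling sum. The excess over
    [2 * ustat_var] is due to [D] and only of order n^2. *)
Let avg_Q2 : avg Q2 = 2 * (ustat_var + avg (fun V => D V ^+ 2)).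
Proof.
have -> : avg Q2 = avg (resampling_sum (fun V W => (X V - X W) *
   ((X V - avg X) - (X W - avg X)))).
  apply: eq_avg => V; apply: eq_bigr => k _; apply: eq_avg => t; lra.
rewrite (@avg_resampling_sum_antisym _ _ _ (fun V W => X V - X W) (fun V => X V - avg X)).
  congr (_ * _); rewrite /ustat_var -XD -avgD; apply: eq_avg => V.
  by rewrite resampling_sum_ustat; lra.
by move=> V W; rewrite opprB.
Qed.

Let avg_Q3 : avg Q3 = 0.
Proof.
have h3 : avg Q3 = - avg Q3.
  rewrite -avgN [LHS]avg_resampling_sum_swap; apply: eq_avg => V.
  rewrite /Q3 /resampling_sum -sumrN; apply: eq_bigr => k _.
  by rewrite -avgN; apply: eq_avg => t; rewrite distrC; lra.
lra.
Qed.

(** In 18 = 6 + 12 the 6 comes from the fluctuations of [Q2], where the factor 2 cancels a 1/2, and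
    the 12 from those of [Q3], whose mean is 0. The coefficient 4 is the bias of [Q2]; the square
    root is the contribution of [D]. *)
Theorem ustat_berry_esseen (c : R) (Phi : R -> R) (x : R) : gauss_cdf c Phi ->
  0 < ustat_var ->
  `|avg (fun V => (X V <= x)%R%:R) - Phi ((x - avg X) / Num.sqrt ustat_var)| <=
  (18 * Num.sqrt n * n ^+ 2 * K ^+ 2 + 4 * n ^+ 2 * K ^+ 2) / ustat_var
   + 5 * Num.sqrt (2 * n ^+ 2 * K ^+ 2 / ustat_var).
Proof.
move=> HPhi s0; set s := Num.sqrt ustat_var.
have sp : 0 < s by rewrite sqrtr_gt0.
have ss : s ^+ 2 = ustat_var by rewrite sqr_sqrtr// ltW.
pose W V := (X V - avg X) / s.
have := exchangeable_pair_bound HPhi T0 W ((x - avg X) / s).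
have -> : avg (fun V => (W V <= (x - avg X) / s)%R%:R) = avg (fun V => (X V <= x)%R%:R) :> R.
  by apply: eq_avg => V; rewrite /W ler_pM2r ?invr_gt0// lerD2r.
move=> /le_trans; apply.
have dW U V : W U - W V = (X U - X V) / s by rewrite /W; lra.
have nK0 : 0 <= 6 * n ^+ 2 * K ^+ 2 by rewrite !mulr_ge0// sqr_ge0.
have sqn : Num.sqrt (n * (6 * n ^+ 2 * K ^+ 2) ^+ 2) = Num.sqrt n * (6 * n ^+ 2 * K ^+ 2).
  by rewrite sqrtrM// sqrtr_sqr ger0_norm.
have eD := avg_degen_sqr.
apply: (@le_trans _ _ ((6 * Num.sqrt n * n ^+ 2 * K ^+ 2 + 4 * n ^+ 2 * K ^+ 2) / ustat_var +
  (12 * Num.sqrt n * n ^+ 2 * K ^+ 2) / ustat_var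
   + 5 * Num.sqrt (2 * n ^+ 2 * K ^+ 2 / ustat_var))); last by lra.
apply: lerD; first apply: lerD.
- have -> : avg (fun V => `|1 - resampling_sum (fun V V' => (W V - W V') ^+ 2) V / 2|)
      = avg (fun V => `|2 * ustat_var - Q2 V|) * ((2 * ustat_var)^-1).
    rewrite -avgZr; apply: eq_avg => V.
    have -> : resampling_sum (fun V V' => (W V - W V') ^+ 2) V = Q2 V / ustat_var.
      rewrite /Q2 /resampling_sum mulr_suml; apply: eq_bigr => k _.
      by rewrite -avgZr; apply: eq_avg => t; rewrite dW expr_div_n ss.
    have g0 : 0 <= (2 * ustat_var)^-1 by rewrite invr_ge0 mulr_ge0 ?(ltW s0).
    rewrite -[(2 * ustat_var)^-1](ger0_norm g0).
    have u0 : 2 * ustat_var != 0 by rewrite mulf_neq0 ?pnatr_eq0// lt0r_neq0.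
    by rewrite -normrM mulrBl divff// [(2 * _)^-1]invfM [2^-1 * _]mulrC mulrA.
  have h2 : avg (fun V => `|2 * ustat_var - Q2 V|) <=
      2 * avg (fun V => D V ^+ 2) + Num.sqrt n * (6 * n ^+ 2 * K ^+ 2).
    have hv : avg (fun V => `|Q2 V - avg Q2|) <= Num.sqrt n * (6 * n ^+ 2 * K ^+ 2).
      rewrite -sqn; apply: (avg_norm_sqrt O0); apply: (@resampling_sum_variance (fun x => x ^+ 2)).
        move=> y z; rewrite (_ : y ^+ 2 - z ^+ 2 = (y - z) * (y + z)); last by lra.
        by rewrite normrM ler_wpM2l// ler_normD.
      by rewrite expr0n.
    rewrite addrC; apply: (le_trans _ (lerD hv (lexx _))).
    rewrite -[X in _ + X](avg_cst O0) -avgD; apply: ler_avg => V.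
    have -> : 2 * ustat_var - Q2 V = - (Q2 V - avg Q2) - 2 * avg (fun V => D V ^+ 2).
      by rewrite avg_Q2; lra.
    apply: (le_trans (ler_normB _ _)); rewrite normrN lerD2l ger0_norm// mulr_ge0//.
    by apply: avg_ge0 => U; exact: sqr_ge0.
  rewrite invfM [_ * (2^-1 * _)]mulrA mulrA ler_wpM2r ?invr_ge0 ?(ltW s0)//.
  lra.
- have -> : avg (fun V => `|resampling_sum (fun V V' => (W V - W V') * `|W V - W V'|) V|)
     = avg (fun V => `|Q3 V|) / ustat_var.
    rewrite -avgZr; apply: eq_avg => V.
    have g0 : 0 <= ustat_var^-1 by rewrite invr_ge0 (ltW s0).
    rewrite -[ustat_var^-1](ger0_norm g0) -normrM; congr (`|_|).
    rewrite /Q3 /resampling_sum mulr_suml; apply: eq_bigr => k _.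
    rewrite -avgZr; apply: eq_avg => t; rewrite dW normrM.
    by rewrite (ger0_norm (_ : 0 <= s^-1)) ?invr_ge0 ?ltW// -ss expr2 invfM; lra.
  rewrite mulrA ler_wpM2r ?invr_ge0 ?(ltW s0)//.
  have hv : avg (fun V => `|Q3 V|) <= Num.sqrt n * (6 * n ^+ 2 * K ^+ 2).
    rewrite -sqn; apply: (avg_norm_sqrt O0).
    have := @resampling_sum_variance (fun x => x * `|x|) _ _; rewrite -/Q3 avg_Q3.
    under eq_avg do rewrite subr0.
    apply; last by rewrite mul0r.
    move=> y z.
    have -> : y * `|y| - z * `|z| = (y - z) * `|y| + z * (`|y| - `|z|) by lra.
    apply: (le_trans (ler_normD _ _)); rewrite !normrM normr_id mulrDr lerD2l mulrC.
    by rewrite ler_wpM2r// ler_dist_dist.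
  lra.
rewrite ler_wpM2l//; apply: (avg_norm_sqrt O0).
have -> : avg (fun V => (resampling_sum (fun V V' => W V - W V') V - W V) ^+ 2)
   = avg (fun V => D V ^+ 2) / ustat_var.
  rewrite -avgZr; apply: eq_avg => V.
  have -> : resampling_sum (fun V V' => W V - W V') V =
     resampling_sum (fun V V' => X V - X V') V / s.
    rewrite /resampling_sum mulr_suml; apply: eq_bigr => k _.
    by rewrite -avgZr; apply: eq_avg => t; rewrite dW.
  by rewrite resampling_sum_ustat /W -mulrBl addrAC subrr add0r expr_div_n ss.
by rewrite ler_wpM2r// invr_ge0 ltW.
Qed.

End u_statistic.

(** * The crossing kernel *)

Section circular_sums.
Variable R : realType.

Lemma sum_ord_between (M a b : nat) :
  (\sum_(c < M) ((c < a) && (b < c)) = minn M a - b.+1)%N.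
Proof.
elim: M => [|M IH]; first by rewrite big_ord0; lia.
by rewrite big_ord_recr/= IH; lia.
Qed.

Lemma sum_ord_lt (M b : nat) : (\sum_(c < M) (c < b) = minn M b)%N.
Proof.
elim: M => [|M IH]; first by rewrite big_ord0; lia.
by rewrite big_ord_recr/= IH; lia.
Qed.

Lemma sum_ord_gt (M a : nat) : (\sum_(c < M) (a < c) = M - a.+1)%N.
Proof.
elim: M => [|M IH]; first by rewrite big_ord0; lia.
by rewrite big_ord_recr/= IH; lia.
Qed.

(* [b |-> a - b] modulo [M] permutes the residues, and [psi] is even on them. *)
Lemma sum_circular (M : nat) (psi : nat -> R) (a : nat) : (a < M)%N -> psi 0%N = 0 ->
  (forall t, (0 < t < M)%N -> psi (M - t)%N = psi t) ->
  \sum_(b < M) (psi (a - b)%N + psi (b - a)%N) = \sum_(t < M) psi t.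
Proof.
move=> aM psi0 psiM; rewrite big_split/=.
rewrite -!(big_mkord xpredT (fun b => psi (a - b)%N)).
rewrite -!(big_mkord xpredT (fun b => psi (b - a)%N)) -(big_mkord xpredT psi).
rewrite (@big_cat_nat _ _ _ a 0 M)//=; last exact: ltnW.
rewrite [X in _ + X + _]big1_seq ?addr0; last first.
  by move=> b /andP[_]; rewrite mem_index_iota => /andP[ab _]; rewrite (_ : a - b = 0)%N//; lia.
rewrite [X in _ + X](@big_cat_nat _ _ _ a 0 M)//=; last exact: ltnW.
rewrite [X in _ + (X + _)]big1_seq ?add0r; last first.
  by move=> b /andP[_]; rewrite mem_index_iota => /andP[_ ab]; rewrite (_ : b - a = 0)%N//; lia.
rewrite [X in _ + X](_ : _ = \sum_(0 <= t < M - a) psi t); last first.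
  transitivity (\sum_(0 + a <= b < M) psi (b - a)%N) => //.
  by rewrite big_addn; apply: eq_bigr => b _; rewrite addnK.
rewrite [RHS](@big_cat_nat _ _ _ (M - a) 0 M)//=; last by lia.
rewrite addrC; congr (_ + _).
transitivity (\sum_(0 + (M - a) <= t < M) psi t) => //.
rewrite big_addn (_ : M - (M - a) = a)%N; last by lia.
apply: eq_big_nat => b /andP[_ ba].
by rewrite -psiM; [congr psi; lia|lia].
Qed.

Lemma sum_sq_split (psi : nat -> R) (a b : nat) : psi 0%N = 0 ->
  (psi (a - b)%N + psi (b - a)%N) ^+ 2 = psi (a - b)%N ^+ 2 + psi (b - a)%N ^+ 2.
Proof.
move=> psi0; have [ab|ba] := leqP a b.
  by rewrite (_ : a - b = 0)%N ?psi0 ?expr0n ?add0r//; lia.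
by rewrite (_ : b - a = 0)%N ?psi0 ?expr0n ?addr0//; lia.
Qed.

(* A chord cutting the circle of [M] positions into arcs of lengths [t] and [M - t] is crossed by
   the chords with one endpoint in the interior of each arc; for [t = 0] truncation gives [0]. *)
Definition gap_count (M t : nat) : R := ((t - 1) * (M - 1 - t))%N%:R.

Lemma gap_count0 (M : nat) : gap_count M 0 = 0.
Proof. by rewrite /gap_count sub0n mul0n. Qed.

(** Writing the grid size as [m.+2] turns the truncated differences into the polynomial
    [j * (m - j)]. *)
Lemma gap_countS (m j : nat) : (j < m.+1)%N ->
  gap_count m.+2 j.+1 = j%:R * (m%:R - j%:R).
Proof.
move=> jm; rewrite /gap_count -natrB; last by lia.
by rewrite -natrM; congr ((_ * _)%N%:R); lia.
Qed.

Lemma gap_count_sum (m : nat) :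
  \sum_(t < m.+2) gap_count m.+2 t = (m%:R ^+ 3 - m%:R) / 6.
Proof.
have key j : (j <= m.+1)%N -> \sum_(t < j.+1) gap_count m.+2 t =
    m%:R * (j%:R * (j%:R - 1) / 2) - (j%:R - 1) * j%:R * (2 * j%:R - 1) / 6.
  elim: j => [|j IH] jm; first by rewrite big_ord1 /gap_count/= mul0n; lra.
  by rewrite big_ord_recr/= IH 1?ltnW// gap_countS// -[j.+1%:R]natr1; lra.
by rewrite key// -[m.+1%:R]natr1; lra.
Qed.

Lemma gap_count_sqr_sum (m : nat) :
  \sum_(t < m.+2) gap_count m.+2 t ^+ 2 = (m%:R ^+ 5 - m%:R) / 30.
Proof.
have key j : (j <= m.+1)%N -> \sum_(t < j.+1) gap_count m.+2 t ^+ 2 =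
    m%:R ^+ 2 * ((j%:R - 1) * j%:R * (2 * j%:R - 1) / 6)
    - 2 * m%:R * (j%:R * (j%:R - 1) / 2) ^+ 2
    + (j%:R - 1) * j%:R * (2 * j%:R - 1) * (3 * (j%:R - 1) ^+ 2 + 3 * (j%:R - 1) - 1) / 30.
  elim: j => [|j IH] jm; first by rewrite big_ord1 /gap_count/= mul0n; lra.
  by rewrite big_ord_recr/= IH 1?ltnW// gap_countS// -[j.+1%:R]natr1; lra.
by rewrite key// -[m.+1%:R]natr1; lra.
Qed.

Lemma gap_count_opp (M t : nat) : (0 < t < M)%N -> gap_count M (M - t) = gap_count M t.
Proof.
by move=> tM; rewrite /gap_count mulnC; congr (_ * _)%N%:R; lia.
Qed.

End circular_sums.

Definition interlace (a b c d : nat) : bool := [&& c < a, b < c & d < b]%N.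

(* At most one of the eight interlaced orders of two pairs of endpoints can occur. *)
Lemma interlace_sym_le1 (a b c d : nat) :
  (interlace a b c d + interlace c d a b + (interlace b a c d + interlace c d b a)
  + (interlace a b d c + interlace d c a b + (interlace b a d c + interlace d c b a)) <= 1)%N.
Proof. by rewrite /interlace; lia. Qed.

Section crossing_kernel.
Variables (R : realType) (r M : nat).
Local Notation T := {ffun 'I_r -> 'I_M}.

(** Counts the crossings whose largest endpoint belongs to [u]. All index pairs may be summed: [K_r]
    is complete, and interlacing excludes [i = j] and [i' = j']. *)
Definition crossings_above (u v : T) : R :=
  \sum_i \sum_j \sum_i' \sum_j' (interlace (u i) (u j) (v i') (v j'))%:R.

Definition crossing_kernel (u v : T) : R := crossings_above u v + crossings_above v u.

Let Y (a b c d : nat) : R := (interlace a b c d)%:R + (interlace c d a b)%:R.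

Lemma crossing_kernel_sym u v : crossing_kernel u v = crossing_kernel v u.
Proof. by rewrite /crossing_kernel addrC. Qed.

Lemma crossing_kernel_ge0 u v : 0 <= crossing_kernel u v.
Proof. by rewrite addr_ge0// !sumr_ge0// => i _; rewrite !sumr_ge0// => j _;
  rewrite !sumr_ge0// => k _; rewrite !sumr_ge0. Qed.

Lemma crossing_kernelE u v :
  crossing_kernel u v = \sum_i \sum_j \sum_i' \sum_j' Y (u i) (u j) (v i') (v j').
Proof.
rewrite /crossing_kernel /crossings_above [X in _ + X](_ : _ =
    \sum_i \sum_j \sum_i' \sum_j' (interlace (v i') (v j') (u i) (u j))%:R).
  rewrite -big_split/=; apply: eq_bigr => i _; rewrite -big_split/=; apply: eq_bigr => j _.
  by rewrite -big_split/=; apply: eq_bigr => i' _; rewrite -big_split.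
under eq_bigr do rewrite exchange_big/=.
rewrite exchange_big/=; apply: eq_bigr => k _.
under eq_bigr do rewrite exchange_big/=.
by rewrite exchange_big.
Qed.

Let Y_diagl (a c d : nat) : Y a a c d = 0.
Proof.
rewrite /Y (_ : interlace a a c d = false); last by rewrite /interlace; lia.
by rewrite (_ : interlace _ _ _ _ = false) ?addr0//; rewrite /interlace; lia.
Qed.

Let Y_diagr (a b c : nat) : Y a b c c = 0.
Proof.
rewrite /Y (_ : interlace a b c c = false); last by rewrite /interlace; lia.
by rewrite (_ : interlace _ _ _ _ = false) ?addr0//; rewrite /interlace; lia.
Qed.

Let Y_sym_le1 (a b c d : nat) :
  Y a b c d + Y b a c d + Y a b d c + Y b a d c <= 1.
Proof.
by rewrite /Y -!natrD -[leRHS]/(1%:R) ler_nat; have := interlace_sym_le1 a b c d; lia.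
Qed.

Definition nedges : R := r%:R * (r%:R - 1) / 2.

Let sum_neq : (0 < r)%N -> \sum_(i < r) \sum_(j < r) (i != j)%:R = 2 * nedges :> R.
Proof.
move=> r0; transitivity (\sum_(i < r) \sum_(j < r | j != i) (1 : R)).
  apply: eq_bigr => i _; rewrite [RHS]big_mkcond/=; apply: eq_bigr => j _.
  by rewrite eq_sym; case: (j != i).
by rewrite sum_offdiagl ?card_ord// sum_cst card_ord /nedges; lra.
Qed.

(** Reversing either chord gives four expressions for the kernel. In their sum, two ordered pairs of
    distinct indices contribute at most 1, and there are [(2 * nedges) ^+ 2] such choices. *)
Lemma crossing_kernel_le u v : (0 < r)%N -> crossing_kernel u v <= nedges ^+ 2.
Proof.
move=> r0.
pose Z i j i' j' := Y (u i) (u j) (v i') (v j').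
have e1 : crossing_kernel u v = \sum_i \sum_j \sum_i' \sum_j' Z i j i' j'.
  exact: crossing_kernelE.
have e2 : crossing_kernel u v = \sum_i \sum_j \sum_i' \sum_j' Z j i i' j'.
  by rewrite e1 exchange_big.
have e3 : crossing_kernel u v = \sum_i \sum_j \sum_i' \sum_j' Z i j j' i'.
  by rewrite e1; apply: eq_bigr => i _; apply: eq_bigr => j _; rewrite exchange_big.
have e4 : crossing_kernel u v = \sum_i \sum_j \sum_i' \sum_j' Z j i j' i'.
  by rewrite e2; apply: eq_bigr => i _; apply: eq_bigr => j _; rewrite exchange_big.
have e : 4 * crossing_kernel u v =
    \sum_i \sum_j \sum_i' \sum_j' (Z i j i' j' + Z j i i' j' + Z i j j' i' + Z j i j' i').
  transitivity (crossing_kernel u v + crossing_kernel u v + crossing_kernel u v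
     + crossing_kernel u v); first by lra.
  rewrite {1}e1 {1}e2 {1}e3 e4 -!big_split/=; apply: eq_bigr => i _.
  rewrite -!big_split/=; apply: eq_bigr => j _.
  rewrite -!big_split/=; apply: eq_bigr => i' _.
  by rewrite -!big_split.
have : 4 * crossing_kernel u v <=
    \sum_(i < r) \sum_(j < r) \sum_(i' < r) \sum_(j' < r) ((i != j)%:R * (i' != j')%:R).
  rewrite e; apply: ler_sum => i _; apply: ler_sum => j _; apply: ler_sum => i' _.
  apply: ler_sum => j' _; rewrite /Z; have [->|ij] := eqVneq i j.
    by rewrite !Y_diagl /= mul0r !addr0.
  have [->|ij'] := eqVneq i' j'; first by rewrite !Y_diagr /= mulr0 !addr0.
  by rewrite mul1r; exact: Y_sym_le1.
under eq_bigr do under eq_bigr do under eq_bigr do rewrite -mulr_sumr.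
under eq_bigr do under eq_bigr do rewrite -mulr_sumr sum_neq//.
under eq_bigr do rewrite -mulr_suml.
by rewrite -mulr_suml sum_neq//; lra.
Qed.

Let chord_half (a b : 'I_M) : R := avg (fun c : 'I_M => avg (fun d : 'I_M => Y a b c d)).

(** [chord_half a b] vanishes unless [b < a], so the symmetrised kernel depends on the chord and not
    on its orientation. *)
Definition chord_kernel (a b : 'I_M) : R := chord_half a b + chord_half b a.

Hypothesis M0 : (0 < M)%N.

Let IM0 : (0 < #|'I_M|)%N. Proof. by rewrite card_ord. Qed.

(** For [b < a], one endpoint falls strictly between [b] and [a] and the other outside: [c] inside
    with [d] below [b], or [d] inside with [c] above [a]. *)
Let chord_halfE (a b : 'I_M) : chord_half a b = gap_count R M (a - b) / M%:R ^+ 2.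
Proof.
have aM := ltn_ord a; have bM := ltn_ord b.
have Mn : M%:R != 0 :> R by rewrite pnatr_eq0 -lt0n.
rewrite /chord_half /avg -mulr_suml card_ord -mulrA -invfM -expr2; congr (_ / _).
transitivity (((\sum_(c < M) ((c < a) && (b < c))) * (\sum_(d < M) (d < b)) +
   (\sum_(c < M) (a < c)) * (\sum_(d < M) ((d < a) && (b < d))))%N%:R : R).
  rewrite natrD !natrM !natr_sum !mulr_suml -big_split/=; apply: eq_bigr => c _.
  rewrite !mulr_sumr -big_split/=; apply: eq_bigr => d _.
  rewrite /Y -!natrM -!natrD; congr (_%:R); rewrite /interlace.
  by rewrite -!mulnb; lia.
rewrite !sum_ord_between sum_ord_lt sum_ord_gt /gap_count; congr (_%:R).
rewrite (minn_idPr (ltnW aM)) (minn_idPr (ltnW bM)) mulnC -mulnDl mulnC subn1 -subnS.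
have [ab|ba] := leqP a b.
  by rewrite (_ : a - b.+1 = 0)%N ?mul0n//; lia.
by congr (_ * _)%N; lia.
Qed.

Lemma chord_kernelE (a b : 'I_M) :
  chord_kernel a b = (gap_count R M (a - b) + gap_count R M (b - a)) / M%:R ^+ 2.
Proof. by rewrite /chord_kernel !chord_halfE mulrDl. Qed.

(** In the random copy each of the [2 * nedges] ordered pairs of distinct indices carries two
    independent uniform points, so all contribute equally. What remains is a sum over the chords of
    [u]. *)
Lemma crossing_kernel_proj u : (0 < r)%N ->
  ustat_proj crossing_kernel u = 2 * nedges * ustat chord_kernel u.
Proof.
move=> r0; rewrite /ustat_proj.
rewrite (eq_avg (fun v => crossing_kernelE u v)) avg_sum.
transitivity (\sum_i \sum_j (2 * nedges * chord_half (u i) (u j))).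
  apply: eq_bigr => i _; rewrite avg_sum; apply: eq_bigr => j _.
  rewrite avg_sum -sum_neq// mulr_suml; apply: eq_bigr => i' _.
  rewrite avg_sum mulr_suml; apply: eq_bigr => j' _.
  have [->|ij'] := eqVneq i' j'.
    rewrite mul0r -[RHS](avg_cst (card_ffun_gt0 'I_r IM0)); apply: eq_avg => v.
    by rewrite Y_diagr.
  by rewrite mul1r (avg_coord2 IM0 (fun c d => Y (u i) (u j) c d)).
under eq_bigr do rewrite -mulr_sumr.
rewrite -mulr_sumr; congr (_ * _); rewrite /ustat.
rewrite [X in _ = _ * X](_ : _ = \sum_i \sum_j chord_kernel (u i) (u j)).
  under [in RHS]eq_bigr do rewrite big_split/=.
  by rewrite big_split/= [X in _ + X]exchange_big/=; lra.
apply: eq_bigr => i _; rewrite [RHS](bigD1 i)//= chord_kernelE subnn /gap_count/= !mul0n.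
by rewrite addr0 mul0r add0r.
Qed.

Lemma chord_kernel_proj (a : 'I_M) :
  ustat_proj chord_kernel a = (\sum_(t < M) gap_count R M t) / M%:R ^+ 3.
Proof.
rewrite /ustat_proj (eq_avg (chord_kernelE a)) avgZr /avg card_ord.
rewrite (sum_circular (ltn_ord a) (gap_count0 R M)); last exact: gap_count_opp.
by rewrite -mulrA -invfM -exprS.
Qed.

Lemma chord_kernel_proj_mean :
  ustat_proj_mean chord_kernel = (\sum_(t < M) gap_count R M t) / M%:R ^+ 3.
Proof. by rewrite /ustat_proj_mean (eq_avg chord_kernel_proj) avg_cst. Qed.

Lemma chord_kernel_proj_var : ustat_proj_var chord_kernel = 0.
Proof.
rewrite /ustat_proj_var -[RHS](avg_cst IM0); apply: eq_avg => a.
by rewrite chord_kernel_proj chord_kernel_proj_mean subrr expr0n.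
Qed.

Lemma chord_kernel_degen_var : ustat_degen_var chord_kernel =
  (\sum_(t < M) gap_count R M t ^+ 2) / M%:R ^+ 5 -
  ((\sum_(t < M) gap_count R M t) / M%:R ^+ 3) ^+ 2.
Proof.
rewrite /ustat_degen_var -[RHS](avg_cst IM0); apply: eq_avg => a.
rewrite (eq_avg (g := fun b => (chord_kernel a b - ustat_proj chord_kernel a) ^+ 2)).
  rewrite variance_avg// -/(ustat_proj chord_kernel a) chord_kernel_proj; congr (_ - _).
  rewrite (eq_avg (g := fun b : 'I_M => (gap_count R M (a - b) ^+ 2 +
     gap_count R M (b - a) ^+ 2) * (M%:R ^+ 2)^-1 ^+ 2)).
    rewrite avgZr /avg card_ord.
    rewrite (@sum_circular _ _ (fun t => gap_count R M t ^+ 2) _ (ltn_ord a)).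
    - by rewrite -mulrA exprVn -invfM -exprM -exprS.
    - by rewrite gap_count0 expr0n.
    - by move=> t tM; rewrite gap_count_opp.
  by move=> b; rewrite chord_kernelE exprMn sum_sq_split ?gap_count0.
move=> b; rewrite /ustat_degen !chord_kernel_proj chord_kernel_proj_mean; congr (_ ^+ 2).
by lra.
Qed.

Lemma chord_kernel_sym a b : chord_kernel a b = chord_kernel b a.
Proof. by rewrite /chord_kernel addrC. Qed.

(** With a constant projection, the U-statistic over [r] points has variance [nedges] times the
    degenerate variance; the factor [2 * nedges] enters squared. *)
Lemma crossing_kernel_proj_var : (0 < r)%N ->
  ustat_proj_var crossing_kernel = 4 * nedges ^+ 3 * ustat_degen_var chord_kernel.
Proof.
move=> r0; have Ir0 : (0 < #|'I_r|)%N by rewrite card_ord.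
have := ustat_var_decomp IM0 chord_kernel_sym Ir0.
rewrite chord_kernel_proj_var mulr0 add0r card_ord => h.
have -> : ustat_proj_var crossing_kernel = (2 * nedges) ^+ 2 * ustat_var 'I_r chord_kernel.
  rewrite /ustat_var -avgZ /ustat_proj_var /ustat_proj_mean; apply: eq_avg => u.
  by rewrite (eq_avg (fun u => crossing_kernel_proj u r0)) avgZ crossing_kernel_proj//; lra.
by rewrite h /nedges; lra.
Qed.

End crossing_kernel.

(** The limit is 1/180; the value 1/200 leaves room for finite [m]. *)
Lemma chord_degen_var_ge (R : realType) (m : nat) : (100 <= m)%N ->
  200^-1 <= ustat_degen_var (@chord_kernel R m.+2).
Proof.
move=> m100; rewrite chord_kernel_degen_var// gap_count_sum gap_count_sqr_sum.
(* After the shift by 100, clearing denominators leaves a polynomial in [x] with nonnegative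
   coefficients. *)
have [x x0 mx] : exists2 x : R, 0 <= x & m%:R = x + 100.
  by exists (m%:R - 100); rewrite ?subrK// subr_ge0 ler_nat.
have Mx : m.+2%:R = x + 102 by rewrite -addn2 natrD mx; lra.
rewrite Mx mx; set A := (_ - _) / 30; set B := (_ - _) / 6.
have M0 : 0 < x + 102 by lra.
have -> : A / (x + 102) ^+ 5 - (B / (x + 102) ^+ 3) ^+ 2 =
    ((x + 102) * A - B ^+ 2) / (x + 102) ^+ 6.
  rewrite mulrBl expr_div_n -exprM; congr (_ - _).
  by rewrite [in RHS]exprS [in RHS]invfM [RHS]mulrACA divff ?mul1r// gt_eqF.
rewrite ler_pdivlMr ?exprn_gt0// /A /B.
have x2 : 0 <= x ^+ 2 by rewrite exprn_ge0.
have x3 : 0 <= x ^+ 3 by rewrite exprn_ge0.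
have x4 : 0 <= x ^+ 4 by rewrite exprn_ge0.
have x5 : 0 <= x ^+ 5 by rewrite exprn_ge0.
have x6 : 0 <= x ^+ 6 by rewrite exprn_ge0.
lra.
Qed.

Lemma crossing_kernel_proj_var_ge (R : realType) (r m : nat) : (0 < r)%N -> (100 <= m)%N ->
  nedges R r ^+ 3 / 50 <= ustat_proj_var (@crossing_kernel R r m.+2).
Proof.
move=> r0 m100; rewrite crossing_kernel_proj_var//.
have C0 : 0 <= nedges R r ^+ 3.
  by rewrite exprn_ge0// divr_ge0// mulr_ge0// subr_ge0 ler1n.
have := ler_wpM2l C0 (chord_degen_var_ge R m100); lra.
Qed.

(** [s] is the square root of n, [C] the number of edges of a copy. Since [s >= 10] and [C <= 3],
    the first quotient is at most [56 * 3 * 18.4 / s], below [3100 / s], and the square root is at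
    most [sqrt 336 / s], below [20 / s]. *)
Lemma berry_esseen_constant (R : realType) (s C v : R) : 10 <= s -> 1 <= C <= 3 ->
  s ^+ 6 * C ^+ 3 / 56 <= v ->
  (18 * s * (s ^+ 2) ^+ 2 * (C ^+ 2) ^+ 2 + 4 * (s ^+ 2) ^+ 2 * (C ^+ 2) ^+ 2) / v
   + 5 * Num.sqrt (2 * (s ^+ 2) ^+ 2 * (C ^+ 2) ^+ 2 / v) <= 3620 / s.
Proof.
move=> s10 /andP[C1 C3] vge.
have C30 : 0 < C ^+ 3 by rewrite exprn_gt0//; lra.
have s50 : 0 < s ^+ 5 by rewrite exprn_gt0//; lra.
have s60 : 0 < s ^+ 6 by rewrite exprn_gt0//; lra.
have v0 : 0 < v by apply: lt_le_trans vge; rewrite divr_gt0// mulr_gt0.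
have sp : 0 < s by lra.
have h1 : (18 * s * (s ^+ 2) ^+ 2 * (C ^+ 2) ^+ 2 + 4 * (s ^+ 2) ^+ 2 * (C ^+ 2) ^+ 2) / v
   <= 3100 / s.
  rewrite ler_pdivrMr// [leRHS]mulrAC ler_pdivlMr//.
  apply: (@le_trans _ _ (3100 * (s ^+ 6 * C ^+ 3 / 56))); last by lra.
  have h : (18 * s + 4) * C <= 3100 / 56 * s.
    have : (18 * s + 4) * C <= (18 * s + 4) * 3 by rewrite ler_wpM2l//; lra.
    lra.
  have := ler_wpM2l (ltW (mulr_gt0 s50 C30)) h; lra.
have h2 : Num.sqrt (2 * (s ^+ 2) ^+ 2 * (C ^+ 2) ^+ 2 / v) <= 20 / s.
  have d0 : 0 <= 20 / s by rewrite divr_ge0// ltW.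
  rewrite -[20 / s]ger0_norm// -sqrtr_sqr ler_wsqrtr//.
  rewrite ler_pdivrMr// expr_div_n [leRHS]mulrAC ler_pdivlMr ?exprn_gt0//.
  apply: (@le_trans _ _ (20 ^+ 2 * (s ^+ 6 * C ^+ 3 / 56))); last by lra.
  have h : 2 * C <= 400 / 56 by lra.
  have := ler_wpM2l (ltW (mulr_gt0 s60 C30)) h; lra.
have si : 0 < s^-1 by rewrite invr_gt0.
lra.
Qed.

Lemma nedges_bounds (R : realType) (r : nat) : (2 <= r <= 3)%N -> 1 <= nedges R r <= 3.
Proof.
move=> r23; have [->|->] : r = 2%N \/ r = 3%N by lia.
  by apply/andP; split; rewrite /nedges; lra.
by apply/andP; split; rewrite /nedges; lra.
Qed.

(** * Berry-Esseen bound on a finite grid *)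

Section discretised_bound.
Variables (R : realType) (n r m : nat).
Hypothesis n100 : (100 <= n)%N.
Hypothesis r23 : (2 <= r <= 3)%N.
Hypothesis m100 : (100 <= m)%N.
Local Notation T := {ffun 'I_r -> 'I_m.+2}.
Local Notation ker := (@crossing_kernel R r m.+2).
Local Notation C := (nedges R r).
Local Notation X := (@ustat R 'I_n T ker).
Local Notation v := (@ustat_var R 'I_n T ker).

Let r0 : (0 < r)%N. Proof. by case/andP: r23 => /ltnW. Qed.
Let T0 : (0 < #|T|)%N. Proof. by rewrite card_ffun expn_gt0 card_ord. Qed.
Let I0 : (0 < #|'I_n|)%N. Proof. by rewrite card_ord (leq_trans _ n100). Qed.

Lemma crossing_ustat_var_ge : n%:R ^+ 3 * C ^+ 3 / 56 <= v.
Proof.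
have := ustat_var_ge T0 (@crossing_kernel_sym R r m.+2) I0; rewrite card_ord.
apply: le_trans.
have := crossing_kernel_proj_var_ge R r0 m100; set z := ustat_proj_var _ => hz.
have nn : (100 : R) <= n%:R by rewrite ler_nat.
have /andP[C1 _] := nedges_bounds R r23.
have C0 : 0 <= C ^+ 3 by rewrite exprn_ge0//; lra.
have n0 : 0 <= (n%:R - 1) ^+ 2 * n%:R :> R by rewrite mulr_ge0 ?sqr_ge0.
have := ler_wpM2l n0 hz; apply: le_trans.
(* The loss from [n] to [n - 1], at most 50/56 in the relevant range, turns 1/50 into 1/56. *)
have h : 50 / 56 * n%:R ^+ 3 <= (n%:R - 1) ^+ 2 * n%:R :> R.
  by rewrite [n%:R ^+ 3]exprSr mulrA ler_wpM2r//; nra.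
have := ler_wpM2r C0 h; lra.
Qed.

Lemma crossing_ustat_berry_esseen (c : R) (Phi : R -> R) (x : R) : gauss_cdf c Phi ->
  `|avg (fun V => (X V <= x)%R%:R) - Phi ((x - avg X) / Num.sqrt v)| <= 3620 / Num.sqrt n%:R.
Proof.
move=> HPhi.
have /andP[C1 C3] := nedges_bounds R r23.
have nn : (100 : R) <= n%:R by rewrite ler_nat.
pose s : R := Num.sqrt n%:R.
have s2 : s ^+ 2 = n%:R by rewrite sqr_sqrtr.
have s10 : 10 <= s.
  by rewrite -(ger0_norm (_ : 0 <= 10)) ?ler0n// -sqrtr_sqr ler_wsqrtr//; lra.
have vge := crossing_ustat_var_ge; rewrite -s2 -exprM in vge.
have v0 : 0 < v.
  by apply: lt_le_trans vge; rewrite divr_gt0// mulr_gt0// exprn_gt0//; lra.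
have := ustat_berry_esseen T0 (@crossing_kernel_sym R r m.+2) (@crossing_kernel_ge0 R r m.+2)
  (fun u w => @crossing_kernel_le R r m.+2 u w r0) I0 x HPhi v0.
rewrite card_ord -/s -s2 => /le_trans; apply.
by apply: berry_esseen_constant => //; apply/andP.
Qed.

End discretised_bound.

(** * Random positions and random permutations *)

Section position_crossings.
Variable G : sgraph.
Local Notation N := (nverts G).

Definition position_crossings (w : 'I_N -> nat) : nat :=
  #|[pred q : 'I_N * 'I_N * 'I_N * 'I_N | let: (a, b, c, d) := q in
     [&& edge a b, edge c d & interlace (w a) (w b) (w c) (w d)]]|.

Lemma crossingsE (s : 'S_N) : crossings s = position_crossings (fun i => s i).
Proof. by apply: eq_card => -[[[a b] c] d]; rewrite !inE. Qed.

Lemma position_crossings_mono (w w' : 'I_N -> nat) :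
  (forall i j, (w i < w j)%N = (w' i < w' j)%N) ->
  position_crossings w = position_crossings w'.
Proof.
by move=> ww; apply: eq_card => -[[[a b] c] d]; rewrite !inE /interlace !ww.
Qed.

Lemma position_crossings_le w : (position_crossings w <= N ^ 4)%N.
Proof.
apply: (leq_trans (max_card _)).
by rewrite !card_prod card_ord !expnS expn0 muln1 !mulnA.
Qed.

Lemma position_crossings_sum (R : realType) w : (position_crossings w)%:R =
  \sum_a \sum_b (edge a b)%:R * (\sum_c \sum_d (edge c d)%:R *
     (interlace (w a) (w b) (w c) (w d))%:R) :> R.
Proof.
rewrite /position_crossings -sum1_card natr_sum big_mkcond/=.
under [RHS]eq_bigr do under eq_bigr do rewrite mulr_sumr.
under [RHS]eq_bigr do under eq_bigr do under eq_bigr do rewrite mulr_sumr.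
rewrite pair_bigA/= pair_bigA/= pair_bigA/=; apply: eq_bigr => -[[[a b] c] d] _ /=.
rewrite inE; case: (edge a b); case: (edge c d); rewrite ?mul0r ?mulr0//= !mul1r.
by case: interlace.
Qed.

End position_crossings.

Section rank_permutation.
Variables (N M : nat) (w : {ffun 'I_N -> 'I_M}).
Hypothesis w_inj : injective w.

Let rank (i : 'I_N) : nat := #|[pred j | (w j < w i)%N]|.

Let rank_lt i : (rank i < N)%N.
Proof.
rewrite -[X in (_ < X)%N]card_ord; apply: proper_card.
by apply/properP; split; [apply/fintype.subsetP|exists i; rewrite ?inE ?ltnn].
Qed.

Let rank_mono i j : (w i < w j)%N -> (rank i < rank j)%N.
Proof.
move=> ij; apply: proper_card; apply/properP; split.
  by apply/fintype.subsetP => k; rewrite !inE => /ltn_trans; apply.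
by exists i; rewrite !inE ?ltnn.
Qed.

Lemma order_permutation : exists p : 'S_N, forall i j, (p i < p j)%N = (w i < w j)%N.
Proof.
have rankE i j : (rank i < rank j)%N = (w i < w j)%N.
  have [/rank_mono//|ji|/val_inj/w_inj ->] := ltngtP (w i) (w j); last by rewrite ltnn.
  by apply/negbTE; rewrite -leqNgt ltnW// rank_mono.
have inj : injective (fun i => Ordinal (rank_lt i)).
  move=> i j /(congr1 val)/= rij; apply/w_inj/val_inj => /=.
  by have := rankE i j; have := rankE j i; rewrite rij !ltnn; lia.
by exists (perm inj) => i j; rewrite !permE /= rankE.
Qed.

End rank_permutation.

Section random_positions.
Variables (R : realType) (G : sgraph).
Local Notation N := (nverts G).

(** If [p] ranks the values of [w], the positions [w (s i)] are ordered as [s * p], and right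
    translation preserves the uniform average. *)
Lemma avg_perm_crossings (M : nat) (w : {ffun 'I_N -> 'I_M}) (F : nat -> R) : injective w ->
  avg (fun s : 'S_N => F (position_crossings (fun i => w (s i)))) =
  avg (fun s : 'S_N => F (crossings s)).
Proof.
move=> /order_permutation[p pw].
rewrite -[RHS](@avg_reindex _ _ _ (fun s : 'S_N => (s * p)%g)); last first.
  by exists (fun s => (s * p^-1)%g) => s; [rewrite mulgK|rewrite mulgKV].
apply: eq_avg => s /=; rewrite crossingsE; congr F; apply: position_crossings_mono => i j.
by rewrite !permM pw.
Qed.

(** Relabelling vertices by a fixed [s] permutes the position vectors, so an average over [s] can be
    inserted. *)
Lemma avg_position_perm (M : nat) (F : nat -> R) :
  avg (fun w : {ffun 'I_N -> 'I_M} => F (position_crossings (fun i => w i))) =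
  avg (fun w : {ffun 'I_N -> 'I_M} =>
    avg (fun s : 'S_N => F (position_crossings (fun i => w (s i))))).
Proof.
have S0 : (0 < #|'S_N|)%N by rewrite card_Sn fact_gt0.
rewrite avg_exchange -[LHS](avg_cst S0); apply: eq_avg => s.
pose act (s : 'S_N) (w : {ffun 'I_N -> 'I_M}) := [ffun i => w (s i)].
rewrite -[LHS](@avg_reindex _ _ _ (act s)); last first.
  exists (act (s^-1)%g) => w; apply/ffunP => i; rewrite !ffunE; first by rewrite permKV.
  by rewrite permK.
apply: eq_avg => w /=; congr F; apply: position_crossings_mono => i j.
by rewrite !ffunE.
Qed.

(** Union bound over ordered pairs of vertices, each colliding with probability [1 / M]. *)
Lemma avg_not_injective (M : nat) : (0 < M)%N ->
  avg (fun w : {ffun 'I_N -> 'I_M} => (~~ injectiveb w)%:R) <= N%:R ^+ 2 / M%:R :> R.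
Proof.
move=> M0; have IM0 : (0 < #|'I_M|)%N by rewrite card_ord.
apply: (@le_trans _ _ (avg (fun w : {ffun 'I_N -> 'I_M} =>
    \sum_i \sum_(j | j != i) (w i == w j)%:R))).
  apply: ler_avg => w; have [_|/injectivePn[i [j ij wij]]] := boolP (injectiveb w).
    by rewrite sumr_ge0// => i _; rewrite sumr_ge0.
  rewrite (bigD1 i)//= (bigD1 j) 1?eq_sym//= wij eqxx -!addrA lerDl addr_ge0//.
    by rewrite sumr_ge0.
  by rewrite sumr_ge0// => k _; rewrite sumr_ge0.
rewrite avg_sum; apply: (@le_trans _ _ (\sum_(i < N) \sum_(j < N) M%:R^-1)); last first.
  by rewrite !sum_cst card_ord; lra.
apply: ler_sum => i _; rewrite avg_sum big_mkcond/=; apply: ler_sum => j _.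
case: ifP => // ji; rewrite (avg_coord2 IM0 (fun u v => (u == v)%:R)) 1?eq_sym//.
rewrite -[leRHS](avg_cst IM0); apply: ler_avg => u.
rewrite /avg card_ord (bigD1 u)//= eqxx big1 ?addr0 ?mul1r// => v vu.
by rewrite eq_sym (negbTE vu).
Qed.

Lemma avg_position_crossings_approx (M : nat) (F : nat -> R) (B : R) : (0 < M)%N ->
  (forall k, (k <= N ^ 4)%N -> `|F k| <= B) ->
  `|avg (fun w : {ffun 'I_N -> 'I_M} => F (position_crossings (fun i => w i))) -
    avg (fun s : 'S_N => F (crossings s))| <= 2 * B * (N%:R ^+ 2 / M%:R).
Proof.
move=> M0 FB.
have B0 : 0 <= B by rewrite (le_trans (normr_ge0 (F 0%N)))// FB.
have S0 : (0 < #|'S_N|)%N by rewrite card_Sn fact_gt0.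
have U0 : (0 < #|{ffun 'I_N -> 'I_M}|)%N by rewrite card_ffun_gt0 ?card_ord.
rewrite avg_position_perm -[X in _ - X](avg_cst U0) -avgB.
apply: (le_trans (ler_norm_avg _)).
apply: (@le_trans _ _ (avg (fun w : {ffun 'I_N -> 'I_M} => 2 * B * (~~ injectiveb w)%:R))).
  apply: ler_avg => w; have [/injectiveP wi|wi] := boolP (injectiveb w).
    by rewrite avg_perm_crossings// subrr normr0 mulr0.
  rewrite mulr1; apply: (le_trans (ler_normB _ _)).
  rewrite [leRHS](_ : _ = B + B); last by lra.
  apply: lerD; apply: (avg_norm_le S0) => s; apply: FB.
    exact: position_crossings_le.
  by rewrite crossingsE position_crossings_le.
by rewrite avgZ ler_wpM2l ?mulr_ge0//; exact: avg_not_injective.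
Qed.

End random_positions.

(** * Copies of a clique *)

Section clique_copies_positions.
Variables (n r : nat).
Hypothesis r0 : (0 < r)%N.

Let enc_lt (k : 'I_n) (a : 'I_r) : (k * r + a < n * r)%N.
Proof.
have := ltn_ord k; have := ltn_ord a => ar kn.
have : (k.+1 * r <= n * r)%N by rewrite leq_mul2r kn orbT.
by rewrite mulSn; lia.
Qed.

Definition clique_vertex (k : 'I_n) (a : 'I_r) : 'I_(n * r) := Ordinal (enc_lt k a).

Let copy_lt (i : 'I_(n * r)) : (i %/ r < n)%N.
Proof. by rewrite ltn_divLR. Qed.

Let slot_lt (i : 'I_(n * r)) : (i %% r < r)%N.
Proof. by rewrite ltn_pmod. Qed.

Definition clique_copy (i : 'I_(n * r)) : 'I_n := Ordinal (copy_lt i).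
Definition clique_slot (i : 'I_(n * r)) : 'I_r := Ordinal (slot_lt i).

Lemma clique_copyK k a : clique_copy (clique_vertex k a) = k.
Proof. by apply: val_inj; rewrite /= divnMDl// divn_small ?addn0. Qed.

Lemma clique_slotK k a : clique_slot (clique_vertex k a) = a.
Proof. by apply: val_inj; rewrite /= modnMDl modn_small. Qed.

Lemma clique_vertexK i : clique_vertex (clique_copy i) (clique_slot i) = i.
Proof. by apply: val_inj; rewrite /= -divn_eq. Qed.

Lemma edge_clique_vertex k l a b :
  @edge (clique_copies n r) (clique_vertex k a) (clique_vertex l b) = (k == l) && (a != b).
Proof.
rewrite /= /clique_copies_edge.
have -> : (clique_vertex k a %/ r == clique_vertex l b %/ r)%N = (k == l).
  by rewrite /= !divnMDl// !divn_small// !addn0.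
have [<-|] := eqVneq k l; rewrite ?andbF ?andbT//=.
by congr (~~ _); apply/eqP/eqP => [/(congr1 clique_slot)|->//]; rewrite !clique_slotK.
Qed.

Lemma sum_clique_vertex (R : realType) (F : 'I_(n * r) -> R) :
  \sum_i F i = \sum_k \sum_a F (clique_vertex k a).
Proof.
rewrite pair_bigA/= (reindex (fun q : 'I_n * 'I_r => clique_vertex q.1 q.2))//=.
exists (fun i => (clique_copy i, clique_slot i)) => i _ /=.
  by rewrite clique_copyK clique_slotK; case: i.
by rewrite clique_vertexK.
Qed.

Lemma sum_clique_edges (R : realType) (F : 'I_(n * r) -> 'I_(n * r) -> R) :
  \sum_i \sum_j (@edge (clique_copies n r) i j)%:R * F i j =
  \sum_k \sum_a \sum_b (a != b)%:R * F (clique_vertex k a) (clique_vertex k b).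
Proof.
rewrite sum_clique_vertex; apply: eq_bigr => k _; apply: eq_bigr => a _.
rewrite sum_clique_vertex.
under eq_bigr do under eq_bigr do rewrite edge_clique_vertex.
rewrite (bigD1 k)//= eqxx [X in _ + X]big1 ?addr0// => l lk.
by rewrite big1// => b _; rewrite eq_sym (negbTE lk) mul0r.
Qed.

Section positions.
Variables (R : realType) (M : nat).
Local Notation T := {ffun 'I_r -> 'I_M}.

Definition flat_positions (V : {ffun 'I_n -> T}) : {ffun 'I_(n * r) -> 'I_M} :=
  [ffun i => V (clique_copy i) (clique_slot i)].

Lemma flat_positions_bij : bijective flat_positions.
Proof.
exists (fun w : {ffun 'I_(n * r) -> 'I_M} =>
    [ffun k => [ffun a => w (clique_vertex k a)]] : {ffun 'I_n -> T}).
  by move=> V; apply/ffunP => k; apply/ffunP => a; rewrite !ffunE clique_copyK clique_slotK.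
by move=> w; apply/ffunP => i; rewrite !ffunE clique_vertexK.
Qed.

(* A crossing needs four distinct vertices. *)
Lemma crossings_above_self (u : T) : (r <= 3)%N -> @crossings_above R r M u u = 0.
Proof.
move=> r3; rewrite /crossings_above big1// => i _; rewrite big1// => j _.
rewrite big1// => i' _; rewrite big1// => j' _.
have [/and3P[h1 h2 h3]|//] := boolP (interlace _ _ _ _).
have neq a b : (u a < u b)%N -> (a : nat) <> b.
  by move=> ab /val_inj e; move: ab; rewrite e ltnn.
have := neq _ _ h1; have := neq _ _ h2; have := neq _ _ h3.
have := neq _ _ (ltn_trans h2 h1); have := neq _ _ (ltn_trans h3 h2).
have := neq _ _ (ltn_trans h3 (ltn_trans h2 h1)).
have := ltn_ord i; have := ltn_ord j; have := ltn_ord i'; have := ltn_ord j'.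
lia.
Qed.

(** A copy has no crossing with itself, so the diagonal drops out; the factor 1/2 in [ustat] offsets
    the symmetrisation of the kernel. *)
Lemma position_crossings_ustat (V : {ffun 'I_n -> T}) : (r <= 3)%N ->
  (@position_crossings (clique_copies n r) (fun i => flat_positions V i))%:R =
  ustat (@crossing_kernel R r M) V.
Proof.
move=> r3; rewrite position_crossings_sum sum_clique_edges.
transitivity (\sum_k \sum_l @crossings_above R r M (V k) (V l)).
  apply: eq_bigr => k _.
  under eq_bigr do under eq_bigr do rewrite sum_clique_edges mulr_sumr.
  under eq_bigr do rewrite exchange_big/=.
  rewrite exchange_big/=; apply: eq_bigr => l _.
  rewrite /crossings_above; apply: eq_bigr => i _; apply: eq_bigr => j _.
  rewrite mulr_sumr; apply: eq_bigr => i' _; rewrite mulr_sumr; apply: eq_bigr => j' _.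
  rewrite !ffunE !clique_copyK !clique_slotK.
  have [->|_] := eqVneq i j.
    by rewrite mul0r (_ : interlace _ _ _ _ = false)// /interlace; lia.
  have [->|_] := eqVneq i' j'.
    by rewrite mul0r mulr0 (_ : interlace _ _ _ _ = false)// /interlace; lia.
  by rewrite !mul1r.
rewrite /ustat; under [in RHS]eq_bigr do rewrite big_split/=.
have e : \sum_(k < n) \sum_(l | l != k) @crossings_above R r M (V k) (V l) =
    \sum_k \sum_l @crossings_above R r M (V k) (V l).
  by apply: eq_bigr => k _; rewrite [RHS](bigD1 k)//= crossings_above_self// add0r.
rewrite big_split/= e.
have -> : \sum_(k < n) \sum_(l | l != k) @crossings_above R r M (V l) (V k) =
    \sum_k \sum_l @crossings_above R r M (V k) (V l).
  rewrite -e (exchange_big_dep predT)//=.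
  by apply: eq_bigr => k _; apply: eq_bigl => l; rewrite eq_sym.
lra.
Qed.

Lemma avg_ustat_positions (F : nat -> R) (f : R -> R) : (r <= 3)%N ->
  (forall k, F k = f k%:R) ->
  avg (fun V : {ffun 'I_n -> T} => f (ustat (@crossing_kernel R r M) V)) =
  avg (fun w : {ffun 'I_(n * r) -> 'I_M} =>
    F (@position_crossings (clique_copies n r) (fun i => w i))).
Proof.
move=> r3 Ff; rewrite -[RHS](avg_reindex _ flat_positions_bij); apply: eq_avg => V /=.
by rewrite Ff position_crossings_ustat.
Qed.

End positions.
End clique_copies_positions.

(** * From the grid to random permutations *)

Section permutation_limit.
Variables (R : realType) (G : sgraph).

(** [F] may be the indicator of a half-line: crossing numbers take finitely many values, so no
    continuity is at stake. The offset [j] makes grid estimates valid only for large sizes available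
    at every [m]. *)
Lemma cvg_avg_position_crossings (F : nat -> R) (j : nat) :
  avg (fun w : {ffun 'I_(nverts G) -> 'I_(m + j).+2} =>
    F (position_crossings (fun i => w i))) @[m --> \oo] -->
  avg (fun s : 'S_(nverts G) => F (crossings s)).
Proof.
pose B := \sum_(k < (nverts G ^ 4).+1) `|F k|.
have FB k : (k <= nverts G ^ 4)%N -> `|F k| <= B.
  move=> kN; rewrite /B (bigD1 (inord k))//= inordK// lerDl.
  by rewrite sumr_ge0.
pose K := 2 * B * (nverts G)%:R ^+ 2.
apply/cvgrPdist_le => e e0; near=> m.
rewrite distrC; apply: (le_trans (avg_position_crossings_approx _ FB)) => //.
rewrite mulrA -/K ler_pdivrMr ?ltr0n// mulrC -ler_pdivrMr//.
apply: (@le_trans _ _ m%:R); last by rewrite ler_nat -addn2 -addnA leq_addr.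
by near: m; exact: nbhs_infty_ger.
Unshelve. all: by end_near. Qed.

End permutation_limit.

Section permutation_bound.
Variables (R : realType) (n r : nat).
Hypothesis n100 : (100 <= n)%N.
Hypothesis r23 : (2 <= r <= 3)%N.
Local Notation G := (clique_copies n r).

Definition perm_mean : R := avg (fun s : 'S_(nverts G) => (crossings s)%:R).
Definition perm_var : R := avg (fun s : 'S_(nverts G) => (crossings s)%:R ^+ 2) - perm_mean ^+ 2.

Let r0 : (0 < r)%N. Proof. by case/andP: r23 => /ltnW. Qed.
Let r3 : (r <= 3)%N. Proof. by case/andP: r23. Qed.

Local Notation ker m := (@crossing_kernel R r (m + 100).+2).
Local Notation Xm m := (@ustat R 'I_n {ffun 'I_r -> 'I_(m + 100).+2} (ker m)).

Let cvg_E (f : R -> R) : avg (fun V => f (Xm m V)) @[m --> \oo] -->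
  avg (fun s : 'S_(nverts G) => f (crossings s)%:R).
Proof.
have -> : (fun m => avg (fun V => f (Xm m V))) = (fun m =>
    avg (fun w : {ffun 'I_(nverts G) -> 'I_(m + 100).+2} =>
      f (@position_crossings G (fun i => w i))%:R)).
  apply/funext => m.
  exact: (@avg_ustat_positions n r r0 R (m + 100).+2 (fun k => f k%:R) f r3 (fun k => erefl)).
exact: (@cvg_avg_position_crossings R G (fun k => f k%:R) 100).
Qed.

Let mean_cvg : avg (Xm m) @[m --> \oo] --> perm_mean.
Proof. exact: (@cvg_E id). Qed.

Let var_cvg : ustat_var 'I_n (ker m) @[m --> \oo] --> perm_var.
Proof.
have -> : (fun m => ustat_var 'I_n (ker m)) =
    (fun m => avg (fun V => Xm m V ^+ 2) - avg (Xm m) ^+ 2).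
  apply/funext => m; rewrite /ustat_var variance_avg//.
  by rewrite !card_ffun_gt0// !card_ord.
apply: cvgB; [exact: (@cvg_E (fun x => x ^+ 2))|].
apply: (@continuous_cvg _ _ _ _ _ _ (fun y : R => y ^+ 2)) mean_cvg.
exact: exprn_continuous.
Qed.

(** The lower bound on the grid is uniform in [m] and survives the limit. *)
Lemma perm_var_gt0 : 0 < perm_var.
Proof.
have C1 : 1 <= nedges R r by have /andP[] := nedges_bounds R r23.
have L0 : 0 < n%:R ^+ 3 * nedges R r ^+ 3 / 56.
  rewrite divr_gt0// mulr_gt0// exprn_gt0//; last by lra.
  by rewrite ltr0n (leq_trans _ n100).
apply: (lt_le_trans L0); apply: (cvgr_to_ge var_cvg); apply: nearW => m.
by apply: crossing_ustat_var_ge; rewrite // leq_addl.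
Qed.

(** The threshold [x] stays fixed while the grid is refined; standardisation converges because the
    limiting variance is positive, and the bound does not involve the grid. *)
Theorem crossings_berry_esseen (c : R) (Phi : R -> R) (x : R) : gauss_cdf c Phi ->
  `|avg (fun s : 'S_(nverts G) => ((crossings s)%:R <= x)%R%:R)
    - Phi ((x - perm_mean) / Num.sqrt perm_var)| <= 3620 / Num.sqrt n%:R.
Proof.
move=> HPhi; have v0 := perm_var_gt0.
have cF := @cvg_E (fun y => (y <= x)%R%:R).
have cPhi : Phi ((x - avg (Xm m)) / Num.sqrt (ustat_var 'I_n (ker m))) @[m --> \oo] -->
    Phi ((x - perm_mean) / Num.sqrt perm_var).
  apply: continuous_cvg; first exact: (is_derive_continuous (gauss_cdf_derive HPhi)).
  apply: cvgM; first by apply: cvgB; [exact: cvg_cst|exact: mean_cvg].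
  apply: cvgV; first by rewrite gt_eqF// sqrtr_gt0.
  by apply: continuous_cvg var_cvg; exact: sqrt_continuous.
apply: (cvgr_to_le (cvg_norm (cvgB cF cPhi))); apply: nearW => m.
by apply: crossing_ustat_berry_esseen HPhi => //; rewrite leq_addl.
Qed.

End permutation_bound.

(** * Moments, laws and the normal distribution function *)

Section uniform_perm_integral.
Variables (R : realType) (N : nat).
Local Notation P := (uniform_perm R N).

Lemma uniform_perm_avg (A : set 'S_N) : P A = (avg (fun s : 'S_N => (s \in A)%:R : R))%:E.
Proof.
rewrite /uniform_perm /avg card_Sn; congr (_ / _)%:E.
rewrite -sum1_card natr_sum big_mkcond/=; apply: eq_bigr => s _.
by rewrite inE; case: (s \in A).
Qed.

Lemma integral_uniform_perm (f : 'S_N -> R) : (forall s, 0 <= f s) ->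
  (\int[P]_s (f s)%:E)%E = (avg f)%:E.
Proof.
move=> f0.
transitivity (\int[P]_s (\sum_(t : 'S_N) (f t)%:E * (\1_[set t] s)%:E))%E.
  apply: eq_integral => s _; rewrite (bigD1 s)//= big1 ?adde0.
    by rewrite indicE mem_set//= mule1.
  move=> t ts; rewrite indicE memNset/= ?mule0//= => st.
  by rewrite st eqxx in ts.
rewrite ge0_integral_sum//; last first.
  by move=> t s _; rewrite mule_ge0// lee_fin.
rewrite /avg mulr_suml -sumEFin; apply: eq_bigr => t _.
rewrite ge0_integralZl_EFin//.
rewrite integral_indic// setIT EFinM; congr (_ * _)%E.
have h : P [set t] = ((#|{perm 'I_N}|%:R : R)^-1)%:E.
  rewrite uniform_perm_avg /avg (bigD1 t)//= mem_set// big1 ?addr0 ?mul1r//.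
  by move=> u ut; rewrite memNset//= => e; rewrite e eqxx in ut.
exact: h.
Qed.

End uniform_perm_integral.

Section crossing_moments.
Variables (R : realType) (G : sgraph).
Local Notation P := (uniform_perm R (nverts G)).

Lemma expectation_crossing_rv :
  ('E_P[@crossing_rv R G])%E = (avg (fun s : 'S_(nverts G) => (crossings s)%:R : R))%:E.
Proof. by rewrite unlock integral_uniform_perm. Qed.

Lemma crossing_meanE :
  crossing_mean R G = avg (fun s : 'S_(nverts G) => (crossings s)%:R).
Proof. by rewrite /crossing_mean expectation_crossing_rv. Qed.

Lemma crossing_varianceE : crossing_variance R G =
  avg (fun s : 'S_(nverts G) => (crossings s)%:R ^+ 2) - crossing_mean R G ^+ 2.
Proof.
have S0 : (0 < #|'S_(nverts G)|)%N by rewrite card_Sn fact_gt0.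
rewrite crossing_meanE -variance_avg// /crossing_variance /variance unlock.
rewrite expectation_crossing_rv/= unlock integral_uniform_perm//= => s.
exact: sqr_ge0.
Qed.

Lemma crossing_law_itv (x : R) : crossing_law R G [set` `]-oo, x]] =
  (avg (fun s : 'S_(nverts G) => ((crossings s)%:R <= x)%R%:R : R))%:E.
Proof.
rewrite /crossing_law /distribution /pushforward /= uniform_perm_avg; congr (_%:E).
apply: eq_avg => s; congr (_%:R); congr nat_of_bool.
apply/idP/idP => [|h]; first by rewrite inE /= in_itv.
by rewrite inE /= in_itv.
Qed.

End crossing_moments.

Section normal_cdf.
Variables (R : realType) (m s : R) (d : measure_display) (Omega : measurableType d).
Variables (P : probability Omega R) (Z : {RV P >-> R}).
Hypothesis s0 : 0 < s.
Hypothesis hZ : forall A : set R, measurable A -> distribution P Z A = normal_prob m s A.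

Definition normal_cdf (x : R) : R := fine (cdf Z x).

Let sn : s != 0. Proof. by rewrite gt_eqF. Qed.

Lemma normal_cdfE x : (normal_cdf x)%:E = cdf Z x.
Proof. by rewrite /normal_cdf fineK// fin_num_measure. Qed.

Lemma is_derive_normal_cdf (x : R) : is_derive x 1 normal_cdf (normal_pdf m s x).
Proof.
have int (y : R) : (@lebesgue_measure R).-integrable [set` Interval -oo%O (BRight y)]
    (EFin \o normal_pdf m s).
  by apply: (integrableS _ _ (@subsetT _ _) (integrable_normal_pdf m s)).
have x1 : x < x + 1 by rewrite ltrDl.
(* The right end [x + 1] only serves to make [x] an interior point. *)
have [||dr e] := @continuous_FTC1 R (normal_pdf m s) -oo%O x (x + 1) x1 (int _).
- by rewrite ltNyr.
- exact: continuous_normal_pdf.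
have cE : (fun y : R => \int[@lebesgue_measure R]_(t in [set` Interval -oo%O (BRight y)])
    normal_pdf m s t) = normal_cdf.
  by apply/funext => y; rewrite /normal_cdf /cdf hZ.
rewrite cE in dr e.
by apply: DeriveDef; rewrite -?derive1E.
Qed.

(** Standardisation of [Z]; the constant [s * normal_peak s] is 1 / sqrt (2 pi). *)
Lemma gauss_cdf_normal :
  gauss_cdf (s * normal_peak s) (fun w => normal_cdf (m + s * w)).
Proof.
split.
- by rewrite mulr_gt0// normal_peak_gt0.
- move=> w.
  have ds : is_derive w (1 : R) (fun w : R => m + s * w) s.
    have h := is_deriveD (is_derive_cst m w (1 : R)) (is_deriveZ s (is_derive_id w (1 : R))).
    by apply: (is_derive_eq h); rewrite scaleRE; lra.
  have h := @is_derive1_comp R normal_cdf (fun w : R => m + s * w) w _ _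
    (is_derive_normal_cdf (m + s * w)) ds.
  apply: (is_derive_eq h).
  rewrite normal_pdfE// /gauss_density /normal_fun addrAC subrr add0r.
  have -> : - (s * w) ^+ 2 / (s ^+ 2 *+ 2) = -1 * (w ^+ 2 / 2).
    rewrite -[s ^+ 2 *+ 2]mulr_natr [(s ^+ 2 * 2)^-1]invfM exprMn.
    transitivity (-1 * (w ^+ 2 / 2) * (s ^+ 2 / s ^+ 2)); first by lra.
    by rewrite (mulfV (expf_neq0 2 sn)) mulr1.
  by lra.
- by move=> w; rewrite fine_ge0.
- by move=> w; rewrite -lee_fin normal_cdfE cdf_le1.
- move=> e w e0.
  have /fine_cvgP[_ /cvgrPdist_lt /(_ e e0) h] := cvg_cdfNy0 Z.
  have [y [y1 y2]] : exists y, normal_cdf y < e /\ y < m + s * w.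
    apply: (@filter_ex _ (-oo%R : set_system R)); near=> y; split.
      have : `|0 - normal_cdf y| < e by near: y.
      by rewrite sub0r normrN; apply: le_lt_trans; exact: ler_norm.
    by near: y; apply: nbhs_ninfty_lt; exact: num_real.
  exists ((y - m) / s); first by rewrite ltr_pdivrMr// mulrC; lra.
  by rewrite mulrCA divff// mulr1 [m + _]addrC subrK.
- move=> e w e0.
  have /fine_cvgP[_ /cvgrPdist_lt /(_ e e0) h] := cvg_cdfy1 Z.
  have [y [y1 y2]] : exists y, 1 - normal_cdf y < e /\ m + s * w < y.
    apply: (@filter_ex _ (+oo%R : set_system R)); near=> y; split.
      have : `|1 - normal_cdf y| < e by near: y.
      by apply: le_lt_trans; exact: ler_norm.
    by near: y; apply: nbhs_pinfty_gt; exact: num_real.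
  exists ((y - m) / s); first by rewrite ltr_pdivlMr// mulrC; lra.
  by rewrite mulrCA divff// mulr1 [m + _]addrC subrK.
Unshelve. all: by end_near. Qed.

End normal_cdf.

Lemma crossing_law_normal (R : realType) (n r : nat) (d : measure_display)
    (Omega : measurableType d) (P : probability Omega R) (Z : {RV P >-> R}) (x : R) :
  (2 <= r <= 3)%N -> (0 < n)%N ->
  normal_rv Z (crossing_mean R (clique_copies n r)) (crossing_variance R (clique_copies n r)) ->
  `|fine (crossing_law R (clique_copies n r) [set` `]-oo, x]]) - fine (cdf Z x)|
    <= 3620 / Num.sqrt n%:R.
Proof.
move=> r23 n0 hZ; rewrite crossing_law_itv /=.
set a := avg _.
have S0 : (0 < #|'S_(nverts (clique_copies n r))|)%N by rewrite card_Sn fact_gt0.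
(* For n < 100 the right-hand side is at least 362, while two numbers in [0, 1] differ by at most
   1. *)
have [n100|n100] := leqP 100 n.
  have v0 := perm_var_gt0 R n100 r23.
  have mE : crossing_mean R (clique_copies n r) = perm_mean R n r by rewrite crossing_meanE.
  have vE : crossing_variance R (clique_copies n r) = perm_var R n r.
    by rewrite crossing_varianceE mE.
  rewrite mE vE in hZ.
  have s0 : 0 < Num.sqrt (perm_var R n r) by rewrite sqrtr_gt0.
  have := crossings_berry_esseen n100 r23 x (gauss_cdf_normal s0 hZ).
  by rewrite mulrCA divff ?gt_eqF// mulr1 [perm_mean _ _ _ + _]addrC subrK.
have a01 : 0 <= a <= 1.
  apply/andP; split; first by apply: avg_ge0.
  by rewrite -[leRHS](avg_cst S0); apply: ler_avg => s; rewrite lern1 leq_b1.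
have c0 : 0 <= fine (cdf Z x) by rewrite fine_ge0.
have c1 : fine (cdf Z x) <= 1 by rewrite -lee_fin normal_cdfE cdf_le1.
have s0 : 0 < Num.sqrt (n%:R : R) by rewrite sqrtr_gt0 ltr0n.
apply: (@le_trans _ _ 1).
  by move: a01 => /andP[a0 a1]; rewrite ler_norml; apply/andP; split; lra.
rewrite ler_pdivlMr// mul1r (@le_trans _ _ 10)//; last by lra.
have -> : 10 = Num.sqrt (10 ^+ 2) :> R by rewrite sqrtr_sqr ger0_norm.
by rewrite ler_wsqrtr// -natrX ler_nat ltnW.
Qed.

(** The two graph events are disjoint, as 2n and 3n differ for positive n, and have total mass 1;
    what lies outside both is null. *)
Lemma cdf_crossings_mixture (R : realType) (n : nat) (p : R) (n0 : (0 < n)%N)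
  (d : measure_display) (Omega : measurableType d) (P : probability Omega R)
  (GG : {RV P >-> sgraph}) (X : {RV P >-> R})
  (hM : P (GG @^-1` [set clique_copies n 2]) = p%:E)
  (hT : P (GG @^-1` [set clique_copies n 3]) = (1 - p)%:E)
  (hX : crossings_of_random_embedding GG X) (x : R) :
  (cdf X x = p%:E * crossing_law R (clique_copies n 2) [set` `]-oo, x]] +
    (1 - p)%:E * crossing_law R (clique_copies n 3) [set` `]-oo, x]])%E.
Proof.
set M := clique_copies n 2; set T := clique_copies n 3.
have MT : M <> T.
  by move=> /(congr1 nverts)/=; lia.
set B := X @^-1` [set` `]-oo, x]].
have mG (H : sgraph) : measurable (GG @^-1` [set H]).
  by rewrite -[X in measurable X]setTI; exact: measurable_funPT.
have mB : measurable B by rewrite -[X in measurable X]setTI; exact: measurable_funPT.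
set U := GG @^-1` [set M] `|` GG @^-1` [set T].
have mU : measurable U by exact: measurableU.
have disj : GG @^-1` [set M] `&` GG @^-1` [set T] = set0.
  by rewrite -subset0 => w [/= h1 h2]; apply: MT; rewrite -h1 -h2.
have PU : P U = 1%E.
  rewrite /U measureU//; transitivity (p%:E + (1 - p)%:E)%E; last first.
    by rewrite -EFinD addrC subrK.
  by rewrite -hM -hT.
have PUC : P (~` U) = 0%E by rewrite probability_setC// PU subee.
rewrite -hM -hT -!hX//; transitivity (P B) => //.
have BE : B = (GG @^-1` [set M] `&` B) `|` (GG @^-1` [set T] `&` B) `|` (B `&` ~` U).
  by rewrite -setIUl -/U setIC -setIUr setUv setIT.
have mM := mG M; have mT := mG T.
have PBE : P B = (P (GG @^-1` [set M] `&` B `|` GG @^-1` [set T] `&` B) + P (B `&` ~` U))%E.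
  rewrite [in LHS]BE measureU//.
  - by apply: measurableU; exact: measurableI.
  - by apply: measurableI => //; exact: measurableC.
  - by rewrite -subset0 => w [hw [_ nU]]; apply: nU; case: hw => -[hw _]; [left|right].
have P0 : P (B `&` ~` U) = 0%E.
  apply/eqP; rewrite eq_le measure_ge0 andbT -PUC.
  by apply: le_measure; rewrite ?inE//; [apply: measurableI => //|]; exact: measurableC.
rewrite PBE P0 adde0 measureU//; [exact: measurableI|exact: measurableI|].
by rewrite setIACA disj set0I.
Qed.

Theorem mainTheorem14 (R : realType) (n : nat) (p : R)
  (hn : (2 <= n)%N) (hp0 : 0 <= p) (hp1 : p <= 1)
  (d : measure_display) (Omega : measurableType d) (P : probability Omega R)
  (GG : {RV P >-> sgraph}) (X : {RV P >-> R})
  (hM : P (GG @^-1` [set clique_copies n 2]) = p%:E)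
  (hT : P (GG @^-1` [set clique_copies n 3]) = (1 - p)%:E)
  (hX : crossings_of_random_embedding GG X)
  (dM : measure_display) (OmegaM : measurableType dM)
  (PM : probability OmegaM R) (ZM : {RV PM >-> R})
  (hZM : normal_rv ZM (crossing_mean R (clique_copies n 2))
                      (crossing_variance R (clique_copies n 2)))
  (dT : measure_display) (OmegaT : measurableType dT)
  (PT : probability OmegaT R) (ZT : {RV PT >-> R})
  (hZT : normal_rv ZT (crossing_mean R (clique_copies n 3))
                      (crossing_variance R (clique_copies n 3))) :
  (kolmogorov_distance (cdf X)
     (fun x => p%:E * cdf ZM x + (1 - p)%:E * cdf ZT x)
   <= (3620 / Num.sqrt n%:R)%:E)%E.
Proof.
have n0 : (0 < n)%N by exact: ltnW.
apply: ge_ereal_sup => _ [x _ <-].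
rewrite (cdf_crossings_mixture n0 hM hT hX x).
have bM := crossing_law_normal x (isT : (2 <= 2 <= 3)%N) n0 hZM.
have bT := crossing_law_normal x (isT : (2 <= 3 <= 3)%N) n0 hZT.
have law_fin (r : nat) : (crossing_law R (clique_copies n r) [set` `]-oo, x]] =
    (fine (crossing_law R (clique_copies n r) [set` `]-oo, x]]))%:E)%E.
  by rewrite fineK// fin_num_measure.
rewrite (law_fin 2%N) (law_fin 3%N) -(normal_cdfE ZM) -(normal_cdfE ZT).
rewrite -!EFinM -!EFinD abse_EFin lee_fin.
rewrite -/(normal_cdf ZM x) -/(normal_cdf ZT x) in bM bT.
set a := fine _ in bM *; set b := fine _ in bT *.
set e := _ / _ in bM bT *.
(* The error is a convex combination of two errors with the same bound. *)
have -> : p * a + (1 - p) * b - (p * normal_cdf ZM x + (1 - p) * normal_cdf ZT x) =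
    p * (a - normal_cdf ZM x) + (1 - p) * (b - normal_cdf ZT x) by lra.
have q0 : 0 <= 1 - p by rewrite subr_ge0.
apply: (le_trans (ler_normD _ _)); rewrite !normrM (ger0_norm hp0) (ger0_norm q0).
have := ler_wpM2l hp0 bM; have := ler_wpM2l q0 bT; lra.
Qed.
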